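(* Let $d\geq 2$, $k\geq 1$ and $\mathbf{k}=(k,k,\dots,k)\in\mathbb{N}^{d+1}$, with $\mathbf{k}\neq(1,1,1)$. Then the automorphism group of the generalized Heawood graph $G_{\mathbf{k}}$ (the dual graph of $T_{\mathbf{k}}$) is generated by the automorphisms induced by $T$, $R$ and $C_{d+1}$, and has cardinality $2(d+1)\det M_{\mathbf{k}}$.
   Context: Let $e_1,\dots,e_{d+1}$ be the standard basis of $\mathbb{R}^{d+1}$, $\widetilde w_i=e_i-\frac1{d+1}\sum_je_j$. $M_{\mathbf{k}}$ is the $(d+1)\times(d+1)$ integer matrix whose $i$-th row has entry $k_i+1$ in column $i$, entry $-k_{i+1}$ in column $i+1$ (indices cyclic mod $d+1$), zeros elsewhere; $\widetilde L_{\mathbf{k}}=\{\sum a_i\widetilde w_i: a=bM_{\mathbf{k}},\ b\in\mathbb{Z}^{d+1}\}$. $V=\{\mathbf{x}:\sum x_i=0\}$; $\Sigma_d$ is the simplicial complex on $V$ cut out by the affine hyperplanes $x_j-x_i=m$ ($i<j$, $m\in\mathbb{Z}$), with vertex set the lattice $\widetilde\Lambda_d=\mathbb{Z}$-span of the $\widetilde w_i$. $T_{\mathbf{k}}$ is the complex of classes of faces of $\Sigma_d$ under translation by $\widetilde L_{\mathbf{k}}$. The generalized Heawood graph $G_{\mathbf{k}}$ is the dual graph of $T_{\mathbf{k}}$ (vertices: facets; edges: pairs of facets sharing a codimension-one face); equivalently it is the graph obtained from the edge graph of the permutahedral tiling by identifying modulo translation by $(d+1)\widetilde L_{\mathbf{k}}$.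 $T$ is the group of automorphisms of $T_{\mathbf{k}}$ induced by translations by vectors of $\widetilde\Lambda_d$, $R$ is induced by $\mathbf{x}\mapsto-\mathbf{x}$, and $C_{d+1}$ is the cyclic group induced by the coordinate shift sending $\widetilde w_i$ to $\widetilde w_{i+1}$; automorphisms of $T_{\mathbf{k}}$ induce automorphisms of its dual graph. *)

(* Defs.v *)
(* MathComp / MathComp-Analysis *)
From HB Require Import structures.
From mathcomp Require Import all_boot all_order all_algebra.
From mathcomp Require Import all_classical all_reals all_analysis.

Set Implicit Arguments.
Unset Strict Implicit.
Unset Printing Implicit Defensive.

Import Order.TTheory GRing.Theory Num.Theory.
Import numFieldNormedType.Exports.

Local Open Scope classical_set_scope.
Local Open Scope card_scope.
Local Open Scope ring_scope.

Section Automorphisms.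
Variable X : Type.

Definition automorphisms (e : X -> X -> Prop) : set (X -> X) :=
  [set f | bijective f /\ forall x y, e (f x) (f y) <-> e x y].

Definition is_subgroup (H : set (X -> X)) : Prop :=
  [/\ H id,
      forall f g, H f -> H g -> H (f \o g) &
      forall f g, H f -> cancel f g -> cancel g f -> H g].

Definition generated (S : set (X -> X)) : set (X -> X) :=
  smallest is_subgroup S.

End Automorphisms.

(* Coordinates are indexed by 'I_d.+1 (from 0), with cyclic successor ordS. *)
Definition Mmat (d : nat) (k : 'I_d.+1 -> nat) : 'M[int]_d.+1 :=
  \matrix_(i, j) (if j == i then (k i).+1%:Z
                  else if j == ordS i then - (k j)%:Z else 0).

Section Complex.
Variables (R : realType) (d : nat).
Local Notation E := 'rV[R]_d.+1.

Definition hyp_space : set E := [set x | \sum_i x 0 i = 0].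

Definition wt (i : 'I_d.+1) : E :=
  delta_mx 0 i - (d.+1%:R)^-1 *: \sum_(j < d.+1) delta_mx 0 j.

Definition wt_comb (a : 'rV[int]_d.+1) : E := \sum_i wt i *~ a 0 i.

Definition Lambda : set E := range wt_comb.

Definition Lk (k : 'I_d.+1 -> nat) : set E :=
  range (fun b : 'rV[int]_d.+1 => wt_comb (b *m Mmat k)).

(* The relatively open cell of the arrangement x_j - x_i = m containing x: the
   points of the hyperplane V on the same side of (or on) each of its members. *)
Definition cell (x : E) : set E :=
  [set y | hyp_space y /\
    forall (i j : 'I_d.+1) (m : int), (i < j)%N ->
      Num.sg (y 0 j - y 0 i - m%:~R) = Num.sg (x 0 j - x 0 i - m%:~R)].

(* The nonempty closed faces of Sigma_d, as subsets of V. *)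
Definition sigma_face : set (set E) :=
  [set F | exists2 x, hyp_space x & F = closure (cell x)].

(* A simplex of dimension n is one with n + 1 vertices. *)
Definition has_dim (F : set E) (n : nat) : Prop :=
  [set v | F v /\ sigma_face [set v]] #= `I_n.+1.

Definition translate_class (k : 'I_d.+1 -> nat) (F : set E) : set (set E) :=
  [set [set x + v | x in F] | v in Lk k].

Definition Tface (k : 'I_d.+1 -> nat) : Type :=
  set_type (translate_class k @` sigma_face).

Section Quotient.
Variable k : 'I_d.+1 -> nat.

Definition Tincl (c c' : Tface k) : Prop :=
  exists F F', [/\ val c F, val c' F' & F `<=` F'].

Definition Tfacets : set (Tface k) :=
  [set c | forall c', Tincl c c' -> c' = c].

Definition Tridges : set (Tface k) :=
  [set c | exists2 F, val c F & has_dim F d.-1].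

Definition Gvertex : Type := set_type Tfacets.

Definition Gadj (u v : Gvertex) : Prop :=
  u <> v /\ exists2 r, Tridges r & Tincl r (val u) /\ Tincl r (val v).

Definition AutG : set (Gvertex -> Gvertex) := automorphisms Gadj.

Definition AutT : set (Tface k -> Tface k) := automorphisms Tincl.

Definition induced_by (phi : E -> E) (g : Tface k -> Tface k) : Prop :=
  forall c, val (g c) = [set phi @` F | F in val c].

Definition shift (x : E) : E := \row_j x 0 (ord_pred j).

Definition Taut : set (Tface k -> Tface k) :=
  AutT `&` [set g | exists2 v, Lambda v & induced_by (fun x => x + v) g].

Definition Raut : set (Tface k -> Tface k) :=
  AutT `&` [set g | induced_by (fun x => - x) g].

Definition Caut : set (Tface k -> Tface k) :=
  AutT `&` [set g | exists n, induced_by (iter n shift) g].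

Definition graph_induced (S : set (Tface k -> Tface k)) :
    set (Gvertex -> Gvertex) :=
  AutG `&` [set f | exists2 g, S g & forall u, val (f u) = g (val u)].

End Quotient.
End Complex.

Arguments AutG R {d} k.
Arguments Taut R {d} k.
Arguments Raut R {d} k.
Arguments Caut R {d} k.

(* Main.v *)
(* Write n = d + 1.  Facets of the arrangement are encoded by integer rows h with
   pairwise distinct residues mod n, modulo constant rows: h stands for the alcove
   containing wt_comb h / n.  Crossing a wall exchanges two entries of consecutive
   residues i and i + 1, by adding 1 to the first and subtracting 1 from the
   second, and translating by a vector of L_k adds n times a row b M_k.

   A nonzero row b M_k has two entries differing by at least 2k + 1, so, outside
   the case (1,1,1), walks of length at most 6 that close up in the quotient
   already close up in the Cayley graph of the affine symmetric group.  Hence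
   4-cycles detect commuting walls, and the hexagons without commuting corners are
   the braid relations.  It follows that the permutation of wall labels by which
   an automorphism acts at one vertex is the same at all adjacent vertices; it
   preserves adjacency in the cyclic diagram, so it is dihedral.  The automorphism
   is then h |-> +-(sigma h + n v) for a permutation sigma of the coordinates that
   preserves the lattice.  The functional v |-> sum_i v_i (k+1)^i k^(n-1-i), taken
   modulo (k+1)^n - k^n = det M_k, shows that sigma is a cyclic shift and that the
   lattice has a cyclic quotient of that order, which gives the count. *)
Require Import Defs.
From mathcomp Require Import all_boot all_order all_algebra.
From mathcomp Require Import all_classical all_reals all_analysis.
From mathcomp Require Import zify lra.
Set Implicit Arguments.
Unset Strict Implicit.
Unset Printing Implicit Defensive.

Import Order.TTheory GRing.Theory Num.Theory.
Import numFieldNormedType.Exports.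

Local Open Scope classical_set_scope.
Local Open Scope card_scope.
Local Open Scope ring_scope.

(** * Affine reflections acting on integer rows *)

(** The number 6 is the length of a braid relation, the longest relation that the rigidity argument
    inspects. One swap changes a difference of two coordinates by at most 2, but two consecutive
    swaps change it by at most 3, so six change it by at most 9. The naive bound 12 would lose the
    case n = 4, k = 1, where n (2 k + 1) = 12; and n (2 k + 1) = 9 happens exactly for (1,1,1),
    which is why this case has to be excluded. The analysis of automorphisms sees the graph only
    through a map [q] from generic rows onto its vertices, with known fibres and adjacency. The
    geometry of the arrangement serves to construct such a [q], and to realize the resulting maps by
    isometries. That an automorphism preserves commutation of labels is visible from 4-cycles; that
    it also reflects commutation comes from finiteness of the label set. *)

Section Residues.
Variable e : nat.
Local Notation n := e.+3.
Local Notation vec := 'rV[int]_n.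

Lemma res_eq0 (m : int) : ((m%:~R : 'I_n) == 0) = (n%:Z %| m)%Z.
Proof.
have natE (p : nat) : ((p%:R : 'I_n) == 0) = (n %| p)%N.
  by rewrite Zp_nat -val_eqE.
case: m => p; first by rewrite -pmulrn natE dvdzE.
by rewrite NegzE mulrNz oppr_eq0 natE !dvdzE abszN.
Qed.

Lemma res_eqP (m p : int) :
  reflect (exists a : int, m = p + n%:Z * a) ((m%:~R : 'I_n) == p%:~R).
Proof.
rewrite -subr_eq0 -intrB res_eq0; apply: (iffP dvdzP) => [] [a E]; exists a.
  by rewrite mulrC -E addrC subrK.
by rewrite E addrC addKr mulrC.
Qed.

Lemma res_mulr (a : int) : (n%:Z * a)%:~R = 0 :> 'I_n.
Proof. by apply/eqP; rewrite res_eq0 dvdz_mulr. Qed.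

Lemma two_neq0 : (1 + 1 : 'I_n) != 0. Proof. by []. Qed.

Lemma one_neqN1 : (1 : 'I_n) != -1.
Proof. by rewrite -addr_eq0. Qed.

Lemma addr1_neq (x : 'I_n) : (x + 1 == x) = false.
Proof. by apply/negbTE; rewrite -subr_eq0 addrAC subrr. Qed.

Lemma addr2_neq (x : 'I_n) : (x + 1 + 1 == x) = false.
Proof. by rewrite -addrA -subr_eq0 [x + _]addrC addrK. Qed.

Lemma ord_cyc_ind (P : 'I_n -> Prop) :
  P 0 -> (forall i, P i -> P (i + 1)) -> forall i, P i.
Proof.
move=> P0 PS i; rewrite -[i]natr_Zp; elim: (val i) => [//|m IH].
by rewrite -natr1; apply: PS.
Qed.

Lemma val_addr1 (x : 'I_n) : x + 1 != 0 -> (x + 1)%R = x.+1 :> nat.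
Proof.
rewrite -val_eqE /=; have := ltn_ord x; rewrite leq_eqVlt => /orP[/eqP xe|lt].
  by case/eqP; rewrite addn1 xe modnn.
by rewrite modnDmr addn1 modn_small.
Qed.

(* The affine simple reflection exchanging the integers congruent to i and i + 1. *)
Definition swapz (i : 'I_n) (m : int) : int :=
  if (m%:~R : 'I_n) == i then m + 1 else
  if (m%:~R : 'I_n) == i + 1 then m - 1 else m.

Variant s_spec (i : 'I_n) (m : int) : int -> Type :=
| SUp of (m%:~R : 'I_n) = i : s_spec i m (m + 1)
| SDown of (m%:~R : 'I_n) = i + 1 : s_spec i m (m - 1)
| SFix of (m%:~R : 'I_n) != i & (m%:~R : 'I_n) != i + 1 : s_spec i m m.

Lemma sP i m : s_spec i m (swapz i m).
Proof.
rewrite /swapz; case: (boolP (_ == i)) => [/eqP|] H1; first exact: SUp.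
by case: (boolP (_ == i + 1)) => [/eqP|] H2; [exact: SDown | exact: SFix].
Qed.

Lemma s_up i (m : int) : (m%:~R : 'I_n) = i -> swapz i m = m + 1.
Proof. by rewrite /swapz => ->; rewrite eqxx. Qed.

Lemma s_down i (m : int) : (m%:~R : 'I_n) = i + 1 -> swapz i m = m - 1.
Proof. by rewrite /swapz => ->; rewrite addr1_neq eqxx. Qed.

Lemma s_fix i (m : int) :
  (m%:~R : 'I_n) != i -> (m%:~R : 'I_n) != i + 1 -> swapz i m = m.
Proof. by rewrite /swapz => /negbTE -> /negbTE ->. Qed.

Lemma sK i : involutive (swapz i).
Proof.
move=> m; case: (sP i m) => [E|E|E1 E2].
- by rewrite s_down ?addrK // intrD E.
- by rewrite s_up ?subrK // intrB E addrK.
- by rewrite s_fix.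
Qed.

Lemma s_mod i m a : swapz i (m + n%:Z * a) = swapz i m + n%:Z * a.
Proof.
rewrite /swapz intrD res_mulr addr0; case: ifP => _; first by rewrite addrAC.
by case: ifP => _ //; rewrite addrAC.
Qed.

Lemma s_shift i m (c : int) : swapz i (m + c) = swapz (i - c%:~R) m + c.
Proof.
rewrite /swapz intrD [i - _ + 1]addrAC ![m%:~R == _ - _]eq_sym !subr_eq.
rewrite ![_ == m%:~R + _]eq_sym.
by do 2![case: ifP => _ //; first by rewrite addrAC].
Qed.

Lemma s_opp i m : swapz i (- m) = - swapz (- i - 1) m.
Proof.
rewrite /swapz intrN !eqr_oppLR opprD subrK.
case: (eqVneq m%:~R (- i)) => [->|ne].
  by rewrite -subr_eq0 opprB addrCA subrr addr0 oner_eq0 opprB addrC.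
by case: ifP => _; rewrite ?opprD ?opprK.
Qed.

Definition comm (i j : 'I_n) := [&& i != j, i != j + 1 & j != i + 1].

Lemma comm_sym i j : comm i j = comm j i.
Proof. by rewrite /comm eq_sym; congr (_ && _); rewrite andbC. Qed.

Lemma s_comm i j m : comm i j -> swapz i (swapz j m) = swapz j (swapz i m).
Proof.
case/and3P=> ij ij1 ji1.
have i1j1 : i + 1 != j + 1 by rewrite (inj_eq (addIr 1)).
case: (sP i m) => [Ei|Ei|Ei Ei1].
- rewrite (@s_fix j m) ?Ei // s_up // s_fix // intrD Ei // eq_sym //.
- rewrite (@s_fix j m) ?Ei // 1?eq_sym // s_down // s_fix // intrB Ei addrK //.
- case: (sP j m) => [Ej|Ej|//]; last by rewrite s_fix.
  + by rewrite s_fix // intrD Ej // eq_sym // eq_sym.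
  + by rewrite s_fix // intrB Ej addrK // eq_sym.
Qed.

Lemma neq_succ (i : 'I_n) : [/\ i != i + 1, i + 1 != i, i + 1 + 1 != i,
  i != i + 1 + 1 & i + 1 != i + 1 + 1].
Proof.
by split; rewrite ?addr1_neq ?addr2_neq // eq_sym ?addr1_neq ?addr2_neq.
Qed.

Lemma s_braid i m (j := i + 1) :
  swapz i (swapz j (swapz i (swapz j (swapz i (swapz j m))))) = m.
Proof.
have [n1 n2 n3 n4 n5] := neq_succ i; rewrite /j.
have F (x : int) : (x%:~R : 'I_n) = i -> swapz (i + 1) x = x.
  by move=> E; rewrite s_fix ?E.
have G (x : int) : (x%:~R : 'I_n) = i + 1 + 1 -> swapz i x = x.
  by move=> E; rewrite s_fix ?E // eq_sym.
have E1 (x : int) : (x + 1)%:~R = x%:~R + 1 :> 'I_n by rewrite intrD.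
have E2 (x : int) : (x - 1)%:~R = x%:~R - 1 :> 'I_n by rewrite intrB.
have E3 (x : int) : (x - 1 - 1)%:~R = x%:~R - 1 - 1 :> 'I_n by rewrite !intrB.
case: (sP (i + 1) m) => [E|E|Ea Eb].
- rewrite (G (m + 1)) ?E1 ?E // (@s_down _ (m + 1)) ?E1 ?E // addrK.
  by rewrite (@s_down _ m) ?E // (F (m - 1)) ?E2 ?E ?addrK // s_up ?E2 ?E ?addrK // subrK.
- rewrite (@s_down i (m - 1)) ?E2 ?E ?addrK // (F (m - 1 - 1)) ?E3 ?E ?addrK ?addrK //.
  have Q : ((m - 1 - 1)%:~R : 'I_n) = i by rewrite E3 E !addrK.
  rewrite (@s_up i (m - 1 - 1)) // subrK.
  have Q2 : ((m - 1)%:~R : 'I_n) = i + 1 by rewrite E2 E addrK.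
  by rewrite (@s_up _ (m - 1)) // subrK G ?E.
have [E|N] := eqVneq (m%:~R : 'I_n) i.
  rewrite (@s_up i m) // (@s_up _ (m + 1)) ?E1 ?E // (G (m + 1 + 1)) ?E1 ?E //.
  by rewrite (@s_down _ (m + 1 + 1)) ?E1 ?E // addrK s_down ?E1 ?E // addrK.
by do 2![rewrite (@s_fix i m) // (@s_fix (i + 1) m) //]; rewrite s_fix.
Qed.

Definition swap_row (i : 'I_n) (h : vec) : vec := map_mx (swapz i) h.

Definition act (w : seq 'I_n) (h : vec) : vec := foldl (fun x i => swap_row i x) h w.

Definition actz (w : seq 'I_n) (m : int) : int := foldl (fun x i => swapz i x) m w.

(* Such an h encodes the alcove of the point [wt_comb h / n]; up to adding a
   constant row, every alcove arises from exactly one h. *)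
Definition gen (h : vec) := injective (fun i => (h 0 i)%:~R : 'I_n).

Lemma actE w h i : act w h 0 i = actz w (h 0 i).
Proof. by elim: w h => [//|j w IH] h /=; rewrite IH mxE. Qed.

Lemma SK i : involutive (swap_row i).
Proof. by move=> h; apply/rowP=> j; rewrite !mxE sK. Qed.

Lemma s_res i (m p : int) :
  (swapz i m)%:~R = (swapz i p)%:~R :> 'I_n -> m%:~R = p%:~R :> 'I_n.
Proof.
move=> /eqP /res_eqP [a]; rewrite -s_mod => /(can_inj (@sK i)) ->.
by rewrite intrD res_mulr addr0.
Qed.

Lemma gen_S i h : gen h -> gen (swap_row i h).
Proof. by move=> gh p q /=; rewrite !mxE => /s_res /gh. Qed.

Lemma gen_act w h : gen h -> gen (act w h).
Proof. by elim: w h => [//|j w IH] h gh; apply/IH/gen_S. Qed.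

Lemma gen_inv h : gen h ->
  exists P : 'I_n -> 'I_n, cancel P (fun i => (h 0 i)%:~R : 'I_n)
                        /\ cancel (fun i => (h 0 i)%:~R : 'I_n) P.
Proof. by move=> /injF_bij [P K1 K2]; exists P. Qed.

Lemma gen_surj h (r : 'I_n) : gen h -> exists p, (h 0 p)%:~R = r.
Proof. by move=> /gen_inv [P [K _]]; exists (P r). Qed.

Lemma actz_mod w m a : actz w (m + n%:Z * a) = actz w m + n%:Z * a.
Proof. by elim: w m => [//|j w IH] m /=; rewrite s_mod IH. Qed.

(** The entries of a generic row meet every residue class, and swaps commute with adding multiples
    of n. Hence the action on generic rows is free. *)
Lemma act_trivial w h : gen h -> act w h = h -> forall m, actz w m = m.
Proof.
move=> gh E m; have [p /eqP] := gen_surj m%:~R gh.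
rewrite eq_sym => /res_eqP [a ->].
by rewrite actz_mod -actE E.
Qed.

(* [level j m] names the block of n consecutive integers containing m when the
   blocks are cut after the residue j; only the j-th reflection changes it. *)
Definition level (j : 'I_n) (m : int) : int :=
  m - Posz (val (m%:~R - j - 1 : 'I_n)).

Lemma val_level_succ (j x : 'I_n) : x != j ->
  val (x + 1 - j - 1) = (val (x - j - 1)).+1.
Proof.
move=> ne; have -> : x + 1 - j - 1 = x - j - 1 + 1 by rewrite subrK addrAC addrK.
by apply: val_addr1; rewrite subrK subr_eq0.
Qed.

Lemma level_fix i j m : i != j -> level j (swapz i m) = level j m.
Proof.
move=> ij; rewrite /level; case: (sP i m) => [E|E|//].
  by rewrite intrD E val_level_succ //; set v := val _; lia.
by rewrite intrB E addrK val_level_succ //; set v := val _; lia.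
Qed.

Lemma level_up j m : (m%:~R : 'I_n) = j -> level j (swapz j m) = level j m + n%:Z.
Proof.
move=> E; rewrite s_up // /level intrD E.
rewrite [j + _ - _]addrC addKr subrr subrr sub0r.
have -> : val (-1 : 'I_n) = e.+2 by rewrite /= !modn_small.
by rewrite /=; lia.
Qed.

(** Only the letter j changes [level j], and its single use changes it by n on an integer that
    arrives there with residue j. *)
Lemma once_nontrivial (w1 w2 : seq 'I_n) j :
  j \notin w1 -> j \notin w2 -> ~ (forall m, actz (w1 ++ j :: w2) m = m).
Proof.
have lev w m : j \notin w -> level j (actz w m) = level j m.
  elim: w m => [//|i w IH] m; rewrite inE negb_or => /andP[ji jw] /=.
  by rewrite IH // level_fix // eq_sym.
have surj w m : exists p, actz w p = m.
  elim: w m => [|i w IH] m; first by exists m.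
  by have [p <-] := IH m; exists (swapz i p); rewrite /= sK.
(* p is chosen so that w1 carries it to the representative of j just before the letter j is
   applied. *)
move=> j1 j2 triv; have [p Ep] := surj w1 (j%:Z).
have := triv p; rewrite /actz foldl_cat /= -!/(actz _ _) Ep => /(congr1 (level j)).
rewrite lev // level_up; last by rewrite -pmulrn natr_Zp.
by rewrite -Ep lev //; lia.
Qed.

End Residues.

(** * Relations of length 4 and 6 in the affine symmetric group *)

Section Words.
Variable e : nat.
Local Notation n := e.+3.
Local Notation vec := 'rV[int]_n.
Implicit Types (i j a b c : 'I_n) (h : vec).

Lemma count_nontrivial (w : seq 'I_n) :
  (forall m, actz w m = m) -> forall j, j \in w -> (1 < count_mem j w)%N.
Proof.
move=> triv j jw; rewrite ltnNge leq_eqVlt ltnS leqn0; apply/negP.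
case/orP=> [c1|]; last by rewrite -leqn0 leqNgt -has_count has_pred1 jw.
case/splitPr: jw c1 triv => w1 w2.
rewrite count_cat /= eqxx addnCA add1n eqSS addn_eq0.
by case/andP=> /eqP/count_memPn n1 /eqP/count_memPn n2; exact: once_nontrivial.
Qed.

(** The representative of i + 1 is moved: it goes down to i, stays, then rises twice. *)
Lemma square_nontrivial i : ~ (forall m, actz [:: i; i + 1; i; i + 1] m = m).
Proof.
have [n1 n2 n3 n4 n5] := neq_succ i.
move/(_ (i + 1 : 'I_n)%R%:Z).
have E : (((i + 1 : 'I_n)%R%:Z)%:~R : 'I_n) = i + 1 by rewrite -pmulrn natr_Zp.
move: E; move: (_%:Z) => m E /=.
have Q : ((m - 1)%:~R : 'I_n) = i by rewrite intrB E addrK.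
rewrite (@s_down _ i m) // (@s_fix _ _ (m - 1)) ?Q // (@s_up _ i) ?Q //.
by rewrite subrK s_up //; lia.
Qed.

Lemma comm_neq i j : comm i j -> i != j. Proof. by case/and3P. Qed.

Lemma not_comm i j : ~~ comm i j -> i != j -> j = i + 1 \/ i = j + 1.
Proof.
by rewrite /comm => /[swap] -> /=; rewrite negb_and !negbK => /orP[]/eqP; auto.
Qed.

(** Every letter occurs at least twice and cyclically consecutive letters differ, so the word is
    abab; [square_nontrivial] then excludes labels that do not commute. *)
Lemma four_cycle a b c d : a != b -> b != c -> c != d -> d != a ->
  (forall m, actz [:: a; b; c; d] m = m) -> [/\ c = a, d = b & comm a b].
Proof.
move=> ab bc cd da triv; have C := count_nontrivial triv.
have ca : c = a.
  have := C a (mem_head _ _); rewrite /= eqxx [b == a]eq_sym (negbTE ab).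
  by rewrite (negbTE da); case: eqVneq.
have db : d = b.
  have := C b; rewrite !inE eqxx orbT => /(_ isT) /=.
  by rewrite eqxx (negbTE ab) [c == b]eq_sym (negbTE bc); case: eqVneq.
split=> //; apply/negPn/negP => /not_comm /(_ ab) [E|E]; subst c d.
  by apply: (@square_nontrivial a); rewrite -E.
apply: (@square_nontrivial b); rewrite -E => m.
by have := triv (swapz b m); move=> /(can_inj (@sK _ b)).
Qed.

(** Adjacency in the affine Dynkin diagram, which is a cycle of length n. *)
Definition neighb i j := (i != j) && ~~ comm i j.

Lemma neighbP i j : reflect (j = i + 1 \/ i = j + 1) (neighb i j).
Proof.
apply: (iffP andP) => [[ij /not_comm]|]; first exact.
rewrite /comm; case=> ->; rewrite ?addr1_neq ?[_ == _ + 1]eq_sym ?addr1_neq //.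
  by rewrite eqxx !andbF.
by rewrite eqxx.
Qed.

Lemma neighb_sym i j : neighb i j = neighb j i.
Proof. by rewrite /neighb eq_sym comm_sym. Qed.

Lemma neighb_neq i j : neighb i j -> i != j. Proof. by case/andP. Qed.

Lemma actz_rot1 i (w : seq 'I_n) :
  (forall m, actz (i :: w) m = m) -> forall m, actz (rcons w i) m = m.
Proof.
move=> triv m; rewrite /actz foldl_rcons -/(actz _ _).
have [p <-] : exists p, swapz i p = m by exists (swapz i m); rewrite sK.
by have /= -> := triv p.
Qed.

Lemma braid i j m : neighb i j -> swapz i (swapz j (swapz i m)) = swapz j (swapz i (swapz j m)).
Proof.
case/neighbP => ->.
  by rewrite -[m in LHS](s_braid i m) !sK.
by rewrite -[m in RHS](s_braid j m) !sK.
Qed.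

(** The hypotheses force n = 3. The word is then the square of a Coxeter element, which moves the
    integers of a suitable residue class by 3 in a constant direction. *)
Lemma triangle_abcabc a b c : neighb a b -> neighb b c -> neighb c a ->
  a != c -> ~ (forall m, actz [:: a; b; c; a; b; c] m = m).
Proof.
have E1 (x : int) : (x + 1)%:~R = x%:~R + 1 :> 'I_n by rewrite intrD.
have E2 (x : int) : (x - 1)%:~R = x%:~R - 1 :> 'I_n by rewrite intrB.
move=> Hab Hbc Hca ac; case: (neighbP _ _ Hab) => [Eb|Ea].
  have [Ec|Ec] := neighbP _ _ Hbc; last first.
    by case/eqP: ac; move: Eb; rewrite Ec => /addIr.
  have [Ea|Ec'] := neighbP _ _ Hca; last first.
    by have := neighb_neq Hbc; rewrite Ec' Eb eqxx.
  have cyc (x : int) : (x%:~R : 'I_n) = a ->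
      swapz c (swapz b (swapz a x)) = x + 1 + 1 + 1.
    by move=> xa; rewrite (@s_up _ a) // (@s_up _ b) ?E1 ?xa // s_up // !E1 xa Ec Eb.
  move/(_ (a : 'I_n)%:Z) => /=.
  have : (((a : 'I_n)%:Z)%:~R : 'I_n) = a by rewrite -pmulrn natr_Zp.
  move: (a%:Z) => x xa; rewrite (cyc x) // cyc; first lia.
  by rewrite !E1 xa -Eb -Ec -Ea.
have [Ec|Eb] := neighbP _ _ Hbc; first by case/eqP: ac; rewrite Ea Ec.
have [Ea'|Ec] := neighbP _ _ Hca.
  by have := neighb_neq Hbc; rewrite -(inj_eq (addIr 1)) -Ea Ea' eqxx.
have cyc (x : int) : (x%:~R : 'I_n) = c ->
    swapz c (swapz b (swapz a x)) = x - 1 - 1 - 1.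
  move=> xc; have x1 : ((x - 1)%:~R : 'I_n) = b + 1 by rewrite E2 xc Ec addrK.
  have x2 : ((x - 1 - 1)%:~R : 'I_n) = c + 1 by rewrite E2 x1 addrK.
  by rewrite (@s_down _ a) -?Ec // (@s_down _ b) // s_down.
move/(_ (c : 'I_n)%:Z) => /=.
have : (((c : 'I_n)%:Z)%:~R : 'I_n) = c by rewrite -pmulrn natr_Zp.
move: (c%:Z) => x xc; rewrite (cyc x) // cyc; first lia.
by rewrite !E2 xc {1}Ec addrK Ea addrK Eb addrK.
Qed.

Lemma two_nontrivial a b : a != b -> ~ (forall m, swapz a (swapz b m) = m).
Proof.
move=> ab triv; have := @count_nontrivial [:: b; a] triv a.
by rewrite !inE eqxx orbT /= eqxx eq_sym (negbTE ab) => /(_ isT).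
Qed.

(* Three distinct letters would each occur exactly twice; around a cycle of
   length at least 4 the middle one would have to occur three times. *)
Lemma hexagon i1 i2 i3 i4 i5 i6 :
  neighb i1 i2 -> neighb i2 i3 -> neighb i3 i4 -> neighb i4 i5 ->
  neighb i5 i6 -> neighb i6 i1 ->
  (forall m, actz [:: i1; i2; i3; i4; i5; i6] m = m) -> i3 = i1.
Proof.
move=> H12 H23 H34 H45 H56 H61 triv; have C := count_nontrivial triv.
apply/eqP; apply/negPn/negP => n31.
have N12 := neighb_neq H12; have N23 := neighb_neq H23; have N34 := neighb_neq H34.
have N45 := neighb_neq H45; have N56 := neighb_neq H56; have N61 := neighb_neq H61.
have C1 := C i1 (mem_head _ _).
have {}C2 : (1 < count_mem i2 [:: i1; i2; i3; i4; i5; i6])%N.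
  by apply: C; rewrite !inE eqxx orbT.
have {C}C3 : (1 < count_mem i3 [:: i1; i2; i3; i4; i5; i6])%N.
  by apply: C; rewrite !inE eqxx !orbT.
have B x y m := @braid x y m.
have TT x y : neighb x y -> ~ (forall m, swapz x (swapz y m) = m).
  by move=> /neighb_neq; exact: two_nontrivial.
rewrite eq_sym in n31.
(* Six positions and three letters used at least twice leave only the patterns abcabc, abcacb and
   abcbac. *)
have {}C : (i4 = i1 /\ i5 = i2 /\ i6 = i3) \/
  (i4 = i1 /\ i5 = i3 /\ i6 = i2) \/ (i4 = i2 /\ i5 = i1 /\ i6 = i3).
  have e41 : i4 == i2 -> (i4 == i1) = false by move/eqP->; rewrite eq_sym; exact/negbTE.
  have e42 : i5 == i2 -> (i5 == i1) = false by move/eqP->; rewrite eq_sym; exact/negbTE.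
  have e43 : i5 == i1 -> (i5 == i3) = false by move/eqP->; exact/negbTE.
  have e44 : i5 == i3 -> (i5 == i2) = false by move/eqP->; rewrite eq_sym; exact/negbTE.
  have e45 : i6 == i2 -> (i6 == i3) = false by move/eqP->; exact/negbTE.
  move: C1 C2 C3; rewrite /= !eqxx [i2 == i1]eq_sym [i3 == i2]eq_sym [i3 == i1]eq_sym.
  rewrite (negbTE n31) (negbTE N12) (negbTE N23) [i4 == i3]eq_sym (negbTE N34).
  rewrite (negbTE N61) !add0n !addn0 !add1n !ltnS !addn_gt0 !lt0b.
  case: (eqVneq i4 i1) e41 => [-> _|_ e41].
    case: (eqVneq i5 i2) e42 e44 => [-> _ _|_ _ _] /=.
      by rewrite (negbTE N23) /= => _ _ /eqP; auto.
    rewrite (negbTE N12) => _ /eqP -> /orP[/eqP ->|/eqP E]; first by auto.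
    by case/eqP: N23.
  rewrite /= => /eqP E5; rewrite E5 in e43 *.
  rewrite (negbTE n31) /= => C2 /eqP E6; right; right; split=> //.
  by move: C2; rewrite E6 [i3 == i2]eq_sym (negbTE N23) (negbTE N12) /= ?orbF => /eqP.
(* In each pattern a and c are consecutive somewhere, so the three labels form a triangle. The last
   two patterns then shrink to two letters by braiding. *)
have {}H61 : neighb i3 i1.
  case: C => [[E _]|[[E _]|[_ [E E']]]]; first by rewrite -E.
    by rewrite -E.
  by rewrite neighb_sym -E -E'.
case: C => [[E4 [E5 E6]]|[[E4 [E5 E6]]|[E4 [E5 E6]]]]; subst i4 i5 i6.
- exact: (triangle_abcabc H12 H23 H61 n31 triv).
- apply: (TT i3 i2); first by rewrite neighb_sym.
  move=> y; have := triv (swapz i2 (swapz i1 y)); rewrite /= (B i3 i1) // (B i1 i2) //.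
  by rewrite !sK => /(can_inj (@sK _ i2)) /(can_inj (@sK _ i1)).
- apply: (TT i1 i2) => // y; have := triv (swapz i1 (swapz i3 y)).
  rewrite /= (B i2 i3) // (B i3 i1) // !sK.
  by move=> /(can_inj (@sK _ i1)) /(can_inj (@sK _ i3)).
Qed.

End Words.

(** * The lattice and short closed walks *)

Section Lattice.
Variables (e k : nat).
Local Notation n := e.+3.
Local Notation vec := 'rV[int]_n.
Local Notation M := (Mmat (fun _ : 'I_n => k)).
Implicit Types (i j p q : 'I_n) (h b : vec) (w : seq 'I_n).

Lemma ordSE i : ordS i = i + 1.
Proof. by apply/val_inj; rewrite /= modnDmr addn1. Qed.

Lemma ord_predE i : ord_pred i = i - 1.
Proof. by rewrite -[i in LHS](subrK 1) -ordSE ordSK. Qed.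

Lemma mulME b j : (b *m M) 0 j = k.+1%:Z * b 0 j - k%:Z * b 0 (j - 1).
Proof.
have ne : j - 1 != j by rewrite -[X in _ != X](subrK 1) eq_sym addr1_neq.
rewrite mxE (bigD1 j) //= (bigD1 (j - 1)) //= big1 ?addr0.
  by rewrite !mxE eqxx eq_sym (negbTE ne) ordSE subrK eqxx mulrN ![_ * b 0 _]mulrC.
move=> i /andP[ij ij1]; rewrite mxE eq_sym (negbTE ij) ordSE -subr_eq.
by rewrite eq_sym (negbTE ij1) mulr0.
Qed.

Definition inL (v : vec) := exists b : vec, v = b *m M.

Definition eqv (h h' : vec) :=
  exists c : int, exists2 l, inL l & h' = h + const_mx c + n%:Z *: l.

Lemma inL0 : inL 0. Proof. by exists 0; rewrite mul0mx. Qed.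

Lemma inLD u v : inL u -> inL v -> inL (u + v).
Proof. by case=> b -> [b' ->]; exists (b + b'); rewrite mulmxDl. Qed.

Lemma inLN u : inL u -> inL (- u).
Proof. by case=> b ->; exists (- b); rewrite mulNmx. Qed.

Lemma inLB u v : inL u -> inL v -> inL (u - v).
Proof. by move=> Lu /inLN; exact: inLD. Qed.

Lemma inLZ (c : int) u : inL u -> inL (c *: u).
Proof. by case=> b ->; exists (c *: b); rewrite scalemxAl. Qed.

Lemma inL_const (c : int) : inL (const_mx c).
Proof. by exists (const_mx c); apply/rowP => j; rewrite mulME !mxE; lia. Qed.

Lemma eqv_refl h : eqv h h.
Proof. by exists 0, 0; [exact: inL0 | apply/rowP => i; rewrite !mxE mulr0 !addr0]. Qed.

Lemma eqv_sym h h' : eqv h h' -> eqv h' h.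
Proof.
case=> c [l Ll ->]; exists (- c), (- l); first exact: inLN.
by apply/rowP => j; rewrite !mxE mulrN addrAC !addrK.
Qed.

Lemma eqv_trans h1 h2 h3 : eqv h1 h2 -> eqv h2 h3 -> eqv h1 h3.
Proof.
case=> c [l Ll ->] [c' [l' Ll' ->]]; exists (c + c'), (l + l'); first exact: inLD.
apply/rowP => j; rewrite !mxE; move: (n%:Z) (h1 0 j) (l 0 j) (l' 0 j) => N x y z.
by rewrite mulrDr; lia.
Qed.

Lemma eqv_addc h (c : int) : eqv h (h + const_mx c).
Proof. by exists c, 0; [exact: inL0 | rewrite scaler0 addr0]. Qed.

Lemma eqv_addL h l : inL l -> eqv h (h + n%:Z *: l).
Proof. by exists 0, l => //; apply/rowP => i; rewrite !mxE addr0. Qed.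

(** If no maximum had a smaller predecessor, walking backwards around the cycle from one maximum
    would make all entries equal. *)
Lemma nonconst_jump b : (exists i, b 0 i != b 0 0) ->
  exists p, (forall i, b 0 i <= b 0 p) /\ b 0 (p - 1) < b 0 p.
Proof.
move=> nc; pose m := [arg max_(i > 0 : 'I_n) b 0 i]%O.
have mP i : b 0 i <= b 0 m by rewrite /m; case: Order.TotalTheory.arg_maxP => // j _; apply.
apply: contrapT => no.
have all i : b 0 (m - i) = b 0 m.
  elim/ord_cyc_ind: i => [|i IH]; first by rewrite subr0.
  apply/eqP; rewrite eq_le mP leNgt; apply/negP => lt; apply: no; exists (m - i).
  by rewrite IH; split=> //; rewrite opprD addrA in lt.
have {}all i : b 0 i = b 0 m by rewrite -(all (m - i)) opprB addrC subrK.
by case: nc => i; rewrite !all eqxx.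
Qed.

(** By [mulME], a maximum preceded by a smaller entry gives a coordinate of at least b_p + k, and a
    minimum preceded by a larger entry gives one of at most b_q - k. Their distance is at least 2 k
    + (b_p - b_q), and b_p - b_q is at least 1. *)
Lemma lattice_range b : (exists i, b 0 i != b 0 0) ->
  exists p q, (k.*2.+1)%:Z <= (b *m M) 0 p - (b *m M) 0 q.
Proof.
move=> nc; have [p [pmax plt]] := nonconst_jump nc.
have [|q [qmin qlt]] := @nonconst_jump (- b).
  by case: nc => i ne; exists i; rewrite !mxE eqr_opp.
have qp : b 0 q < b 0 p.
  move: qlt (pmax (q - 1)); rewrite !mxE ltrN2; exact: lt_le_trans.
move: qlt; rewrite !mxE ltrN2 => qlt; exists p, q; rewrite !mulME.
move: plt qlt qp; move: (b 0 p) (b 0 q) (b 0 (p - 1)) (b 0 (q - 1)) => x y z t.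
(* The only nonlinear facts needed are k (jump - 1) >= 0 at both places; the rest is linear in the
   products. *)
move=> zx yt yx; have Hp : 0 <= k%:Z * (x - z - 1) by apply: mulr_ge0; lia.
have Hq : 0 <= k%:Z * (t - y - 1) by apply: mulr_ge0; lia.
lia.
Qed.

Lemma gap_step i h p q : swap_row i h 0 p - swap_row i h 0 q <= h 0 p - h 0 q + 2.
Proof. by rewrite !mxE; case: sP => _; case: sP => _ *; lia. Qed.

(* Two consecutive swaps cannot both exchange the coordinates p and q in the
   same direction. *)
Lemma gap_step2 i j h p q :
  swap_row i (swap_row j h) 0 p - swap_row i (swap_row j h) 0 q <= h 0 p - h 0 q + 3.
Proof.
have E2 (x : int) : (x - 1)%:~R = x%:~R - 1 :> 'I_n by rewrite intrB.
rewrite !mxE; case: (sP j (h 0 p)) => [Ep|Ep|Ep1 Ep2];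
  case: (sP j (h 0 q)) => [Eq|Eq|Eq1 Eq2];
  case: (sP i) => [Fp|Fp|Fp1 Fp2]; case: (sP i) => [Fq|Fq|Fq1 Fq2]; try lia.
move: Fp Fq; rewrite intrD E2 Ep Eq addrK => <- /eqP.
by rewrite eq_sym addr2_neq.
Qed.

Lemma gap_act w h p q : (size w <= 6)%N ->
  act w h 0 p - act w h 0 q <= h 0 p - h 0 q + 9.
Proof.
have G1 i x := gap_step i x p q; have G2 i j x := gap_step2 i j x p q.
case: w => [|i1 [|i2 [|i3 [|i4 [|i5 [|i6 [|i7 w]]]]]]] // _; rewrite /act /=.
- by lia.
- by have := G1 i1 h; lia.
- by have := G2 i2 i1 h; lia.
- by have := G2 i2 i1 h; have := G1 i3 (swap_row i2 (swap_row i1 h)); lia.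
- by have := G2 i2 i1 h; have := G2 i4 i3 (swap_row i2 (swap_row i1 h)); lia.
- have := G2 i2 i1 h; have := G2 i4 i3 (swap_row i2 (swap_row i1 h)).
  by have := G1 i5 (swap_row i4 (swap_row i3 (swap_row i2 (swap_row i1 h)))); lia.
- have := G2 i2 i1 h; have := G2 i4 i3 (swap_row i2 (swap_row i1 h)).
  by have := G2 i6 i5 (swap_row i4 (swap_row i3 (swap_row i2 (swap_row i1 h)))); lia.
Qed.

(** A generic row has exactly one entry of residue i and one of residue i + 1, so the two changes
    cancel. *)
Lemma sum_S i h : gen h -> \sum_j swap_row i h 0 j = \sum_j h 0 j.
Proof.
move=> /gen_inv [P [PK KP]]; apply/eqP; rewrite -subr_eq0 -sumrB; apply/eqP.
have Pbij : {on xpredT, bijective P} by apply: onW_bij; exists (fun j => (h 0 j)%:~R).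
rewrite (reindex P) //= (bigD1 i) //= (bigD1 (i + 1)) ?addr1_neq //= big1.
  by rewrite !mxE s_up ?PK // s_down ?PK //; lia.
by move=> j /andP[j1 j2]; rewrite mxE s_fix ?PK // subrr.
Qed.

Lemma sum_act w h : gen h -> \sum_j act w h 0 j = \sum_j h 0 j.
Proof. by elim: w h => [//|i w IH] h gh /=; rewrite IH ?sum_S //; exact: gen_S. Qed.

Hypothesis large : ((0 < k) && ((0 < e) || (1 < k)))%N.

(* A closed walk of the quotient graph that does not lift to a closed walk
   displaces two coordinates by at least n (2 k + 1) > 9 from each other. *)
Lemma short_walk_lift w h : (size w <= 6)%N -> gen h -> eqv h (act w h) ->
  act w h = h.
Proof.
move=> sw gh [c [_ [b ->] E]]; have Ei i : act w h 0 i = h 0 i + c + n%:Z * (b *m M) 0 i.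
  by rewrite E !mxE.
have [nc|nnc] := pselect (exists i, b 0 i != b 0 0).
  have [p [q H]] := lattice_range nc.
  have := gap_act h p q sw; rewrite !Ei => G; exfalso.
  have : n%:Z * (k.*2.+1)%:Z <= 9 by nia.
  by case/andP: large => k0 /orP[]; nia.
have bc i : b 0 i = b 0 0 by apply/eqP/negPn/negP => ne; apply: nnc; exists i.
have {}Ei i : act w h 0 i = h 0 i + (c + n%:Z * b 0 0).
  by rewrite Ei mulME bc [b 0 (_ - _)]bc; lia.
(* The displacement is now a constant row, and the invariance of the sum of the entries makes it
   zero. *)
have := sum_act w gh; under eq_bigr do rewrite Ei; rewrite big_split /=.
move=> /eqP; rewrite -subr_eq0 addrAC subrr add0r sumr_const card_ord.
rewrite mulrn_eq0 /= => /eqP z; apply/rowP => i; rewrite Ei z addr0 //.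
Qed.

(** If two neighbours coincide in the quotient, returning along i and leaving along j is a closed
    walk, which lifts. The entry of residue i, which the first swap raises, must then be raised by
    the second as well. *)
Lemma S_inj i j h : gen h -> eqv (swap_row i h) (swap_row j h) -> i = j.
Proof.
move=> gh E; have := @short_walk_lift [:: i; j] (swap_row i h) isT (gen_S gh).
rewrite /= SK => /(_ E) F; have {}F : swap_row j h = swap_row i h by [].
have [p hp] := gen_surj i gh.
have := congr1 (fun v : vec => v 0 p) F; rewrite !mxE (s_up hp).
by case: sP => [Ej _|_|_ _]; [rewrite -hp|lia|lia].
Qed.

End Lattice.

(** * Connectivity by descent on the squared distance *)

Section Connectivity.
Variable e : nat.
Local Notation n := e.+3.
Local Notation vec := 'rV[int]_n.
Implicit Types (i j p q : 'I_n) (h : vec) (w : seq 'I_n).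

(* Along the residues the differences h' - h increase weakly, hence are
   constant because the residues are cyclically ordered. *)
Lemma no_inversion_const h h' : gen h ->
  (forall p q, (h 0 q)%:~R = (h 0 p)%:~R + 1 :> 'I_n ->
     h 0 q - h 0 p - 1 < h' 0 q - h' 0 p) ->
  exists c, h' = h + const_mx c.
Proof.
move=> /gen_inv [P [PK KP]] H.
pose g r := h' 0 (P r) - h 0 (P r).
have gle r : g r <= g (r + 1) by have := H (P r) (P (r + 1)); rewrite !PK /g => /(_ erefl); lia.
have sum0 : \sum_r (g (r + 1) - g r) = 0.
  by rewrite sumrB [X in _ - X](reindex_inj (addIr 1)) subrr.
have geq r : g (r + 1) = g r.
  have nn i : xpredT i -> 0 <= g (i + 1) - g i by rewrite subr_ge0.
  move/eqP: sum0; rewrite psumr_eq0 // => /allP/(_ r (mem_index_enum r)) /=.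
  by rewrite subr_eq0 => /eqP.
have gc r : g r = g 0 by elim/ord_cyc_ind: r => // i; rewrite geq.
by exists (g 0); apply/rowP => j; rewrite !mxE -(gc (h 0 j)%:~R) /g KP addrC subrK.
Qed.

Definition sqdist h h' : int := \sum_i (h 0 i - h' 0 i) ^+ 2.

Lemma sqdist_ge0 h h' : 0 <= sqdist h h'.
Proof. by apply: sumr_ge0 => i _; exact: sqr_ge0. Qed.

Lemma S_swapE h p q : gen h -> (h 0 q)%:~R = (h 0 p)%:~R + 1 :> 'I_n ->
  swap_row (h 0 p)%:~R h = h + delta_mx 0 p - delta_mx 0 q.
Proof.
move=> gh qp; have npq : q != p.
  by apply/eqP => E; move/eqP: qp; rewrite E eq_sym addr1_neq.
apply/rowP => i; rewrite !mxE /=.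
have [->|ip] := eqVneq i p; first by rewrite eq_sym (negbTE npq) s_up // subr0.
have [->|iq] := eqVneq i q; first by rewrite s_down // addr0.
rewrite s_fix ?addr0 ?subr0 //; first by apply: contra ip => /eqP/gh ->.
by rewrite -qp; apply: contra iq => /eqP/gh ->.
Qed.

(** As long as h' does not differ from h by a constant, [no_inversion_const] yields two entries of h
    with consecutive residues that are too far apart compared with h'; swapping them brings h closer
    to h'. *)
Lemma connected h h' : gen h -> gen h' ->
  exists w c, h' = act w h + const_mx c.
Proof.
move=> gh gh'; have [m] := ubnP `|sqdist h h'|%N.
elim: m h gh => // m IH h gh lem.
have [inv|noinv] := pselect (exists p q, (h 0 q)%:~R = (h 0 p)%:~R + 1 :> 'I_n /\
     h' 0 q - h' 0 p <= h 0 q - h 0 p - 1); last first.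
  exists [::]; apply: no_inversion_const => // p q E.
  by rewrite ltNge; apply/negP => le; apply: noinv; exists p, q.
case: inv => p [q [E le]].
have npq : q != p.
  by apply/eqP => F; move/eqP: E; rewrite F eq_sym addr1_neq.
(* Equality would make two entries of h' congruent. The strictness gained is exactly what makes the
   squared distance decrease. *)
have {}le : h' 0 q - h' 0 p < h 0 q - h 0 p - 1.
  rewrite lt_neqAle le andbT; apply/negP => /eqP F; case/eqP: npq; apply: gh' => /=.
  have -> : h' 0 q = h' 0 p + (h 0 q - h 0 p - 1) by rewrite -F addrC subrK.
  by rewrite intrD !intrB E [_ + 1]addrC addrK subrr addr0.
have {IH} := IH (swap_row (h 0 p)%:~R h) (gen_S gh).
case=> [|w [c Ew]]; last by exists ((h 0 p)%:~R :: w), c.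
rewrite -ltnS; apply: leq_trans lem; rewrite ltnS -ltz_nat !gez0_abs ?sqdist_ge0 //.
rewrite (S_swapE gh E) /sqdist (bigD1 p) //= (bigD1 q) //=.
rewrite [ltRHS](bigD1 p) //= [X in _ < _ + X](bigD1 q) //= !addrA.
rewrite (eq_bigr (fun i => (h 0 i - h' 0 i) ^+ 2)).
  rewrite ltrD2r !mxE !eqxx /= [p == q]eq_sym (negbTE npq) /= !expr2.
  by move: le; move: (h 0 p) (h 0 q) (h' 0 p) (h' 0 q) => x y z t; nia.
by move=> i /andP[ip iq]; rewrite !mxE /= (negbTE ip) (negbTE iq) addr0 subr0.
Qed.

End Connectivity.

(** * Rigidity of graph automorphisms *)

Section FiniteMaps.

(** On the finite set of pairs, f induces a permutation whose inverse is one of its powers, so the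
    inverse preserves r too. *)
Lemma inj_preserved_reflected (T : finType) (r : rel T) (f : T -> T) :
  injective f -> (forall x y, r x y -> r (f x) (f y)) ->
  forall x y, r (f x) (f y) -> r x y.
Proof.
move=> fI fr x y; pose g (z : T * T) := (f z.1, f z.2).
have gI : injective g by case=> a b [a' b'] [/fI -> /fI ->].
have it m z : r z.1 z.2 -> r (iter m g z).1 (iter m g z).2.
  by move=> H; elim: m => //= m; exact: fr.
by move=> /(it (order g (g (x, y))).-1 (g (x, y))); rewrite -/(finv g _) finv_f.
Qed.

(** Each step of f along the cycle is +1 or -1, and injectivity forbids turning back, so the sign is
    the same everywhere. *)
Lemma dihedral e (f : 'I_e.+3 -> 'I_e.+3) : injective f ->
  (forall i j, neighb i j -> neighb (f i) (f j)) ->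
  exists2 c, (forall i, f i = i + c) \/ (forall i, f i = - i + c) & True.
Proof.
move=> fI fn; exists (f 0) => //.
have step i : f (i + 1) = f i + 1 \/ f i = f (i + 1) + 1.
  by apply/neighbP/fn/neighbP; left.
have turn i : f (i + 1 + 1) != f i.
  by rewrite (inj_eq fI) addr2_neq.
have minus (x : 'I_e.+3) : x - (x + 1) = -1 by rewrite opprD addrA subrr sub0r.
have dir i : f (i + 1 + 1) - f (i + 1) = f (i + 1) - f i.
  have := turn i; case: (step i) => E1; case: (step (i + 1)) => E2.
  - by rewrite E2 E1 ![_ + 1]addrC !addrK.
  - by rewrite E1 in E2; move/addIr: E2 => ->; rewrite eqxx.
  - by rewrite E1 E2 eqxx.
  - by rewrite E1 minus E2 minus.
have {}dir i : f (i + 1) - f i = f 1 - f 0.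
  by elim/ord_cyc_ind: i => [|i <-]; rewrite ?add0r ?dir.
case: (step 0); rewrite add0r => E; [left|right] => i.
  elim/ord_cyc_ind: i => [|i IH]; first by rewrite add0r.
  by have /eqP := dir i; rewrite E [f 0 + 1]addrC addrK subr_eq IH => /eqP ->;
     rewrite addrA [1 + _]addrC.
elim/ord_cyc_ind: i => [|i IH]; first by rewrite oppr0 add0r.
have /eqP := dir i; rewrite E opprD [_ + (- _ - 1)]addrA subrr add0r subr_eq IH.
by move=> /eqP ->; rewrite opprD -E addrA [-1 - i]addrC.
Qed.

End FiniteMaps.

(** * Labels tracked along walks, for an abstract graph covered by the generic rows *)

Section Rigidity.
Variables (e k : nat).
Local Notation n := e.+3.
Local Notation vec := 'rV[int]_n.
Implicit Types (i j p : 'I_n) (h : vec) (w : seq 'I_n).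
Hypothesis large : ((0 < k) && ((0 < e) || (1 < k)))%N.
Local Notation eqv := (eqv k).
Local Notation inL := (inL k).

Variables (V : Type) (adj : V -> V -> Prop) (q : vec -> V).
Hypothesis q_surj : forall u, exists2 h, gen h & q h = u.
Hypothesis q_eq : forall h h', gen h -> gen h' -> (q h = q h' <-> eqv h h').
Hypothesis q_adj : forall h h', gen h -> gen h' ->
  (adj (q h) (q h') <-> exists i, eqv h' (swap_row i h)).

Variable f : V -> V.
Hypothesis fA : automorphisms adj f.

Let fI : injective f. Proof. by case: fA => /bij_inj. Qed.

(* The neighbours of q h are the q (swap_row i h), but the label i depends on the
   representative h, since adding a constant to h shifts all labels. *)
Definition tracks h h' (pi : 'I_n -> 'I_n) :=
  [/\ gen h, gen h', f (q h) = q h' & forall i, f (q (swap_row i h)) = q (swap_row (pi i) h')].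

Lemma q_S_inj i j h : gen h -> q (swap_row i h) = q (swap_row j h) -> i = j.
Proof.
by move=> gh /(q_eq (gen_S gh) (gen_S gh)) /(S_inj large gh).
Qed.

Lemma tracks_exists h h' : gen h -> gen h' -> f (q h) = q h' ->
  exists pi, tracks h h' pi.
Proof.
move=> gh gh' E.
have loc i : exists j, f (q (swap_row i h)) = q (swap_row j h').
  have [h1 gh1 E1] := q_surj (f (q (swap_row i h))).
  have : adj (f (q h)) (f (q (swap_row i h))).
    apply/(proj2 fA)/(q_adj gh (gen_S gh)); exists i; exact: eqv_refl.
  rewrite E -E1 => /(q_adj gh' gh1) [j E2]; exists j.
  by apply/q_eq => //; exact: gen_S.
by have [pi piP] := choice loc; exists pi.
Qed.

Lemma tracks_inj h h' pi : tracks h h' pi -> injective pi.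
Proof.
case=> gh gh' E H i j ij; apply: (q_S_inj gh); apply: fI.
by rewrite !H ij.
Qed.

Lemma tracks_eq h h' pi pi' : tracks h h' pi -> tracks h h' pi' -> pi =1 pi'.
Proof.
by case=> _ gh' _ H [_ _ _ H'] i; apply: (q_S_inj gh'); rewrite -H -H'.
Qed.

(** The edge labelled i carries the same label seen from its other end, since a swap is an
    involution; hence so does its image. *)
Lemma tracks_S h h' pi i : tracks h h' pi ->
  exists2 pi', tracks (swap_row i h) (swap_row (pi i) h') pi' & pi' i = pi i.
Proof.
case=> gh gh' E H.
have [pi' T] := tracks_exists (gen_S gh) (gen_S gh') (H i).
exists pi' => //; case: T => _ _ _ /(_ i); rewrite SK E => F.
by apply: (q_S_inj (@gen_S _ (pi i) _ gh')); rewrite -F SK.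
Qed.

Lemma closed_walk w h : (size w <= 6)%N -> gen h -> q (act w h) = q h ->
  forall m, actz w m = m.
Proof.
move=> sw gh E; apply: (act_trivial gh).
by apply: (short_walk_lift large) => //; apply/q_eq => //; exact: gen_act.
Qed.

(** The commuting square at h is mapped to a closed walk of length 4, whose labels are constrained
    by [four_cycle]: opposite edges have equal labels. *)
Lemma tracks_comm h h' pi i j (pi' : 'I_n -> 'I_n) : tracks h h' pi -> comm i j ->
  tracks (swap_row i h) (swap_row (pi i) h') pi' -> pi' j = pi j /\ comm (pi i) (pi j).
Proof.
move=> T ij T1; have ne := comm_neq ij.
have piI := tracks_inj T; have pi1I := tracks_inj T1.
have [pi2 T2 E2] := tracks_S j T.
have pi2I := tracks_inj T2.
have [pi1' T1' E1'] := tracks_S i T.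
have E1 : pi' i = pi i by rewrite (tracks_eq T1 T1').
have [gh gh' _ _] := T.
(* y represents the image of the corner opposite to h, reached through j first. The walk goes back
   from y to h' and returns to the same corner through i. *)
pose y := swap_row (pi2 i) (swap_row (pi j) h').
have gy : gen y by do 2!apply: gen_S.
have F : q (act [:: pi2 i; pi j; pi i; pi' j] y) = q y.
  have [_ _ _ H1] := T1; have [_ _ _ H2] := T2.
  rewrite /y /= !SK -H1 -H2; congr (f (q _)).
  by apply/rowP => p; rewrite !mxE [RHS]s_comm.
have triv : forall m, actz [:: pi2 i; pi j; pi i; pi' j] m = m.
  by apply: (closed_walk _ gy F).
have [||||-> -> //] := four_cycle _ _ _ _ triv => //.
- by rewrite -E2 (inj_eq pi2I).
- by rewrite (inj_eq piI) eq_sym.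
- by rewrite -E1 (inj_eq pi1I).
(* If the first and last letters agreed, conjugating by that letter would leave a trivial word of
   two distinct letters. *)
apply/eqP => E; apply: (@two_nontrivial _ (pi i) (pi j)); first by rewrite (inj_eq piI).
by move=> m; have := triv (swapz (pi2 i) m); rewrite /= E sK => /(can_inj (@sK _ _)).
Qed.

Lemma tracks_neighb h h' pi i j : tracks h h' pi ->
  neighb i j -> neighb (pi i) (pi j).
Proof.
move=> T /andP[ij ncij]; rewrite /neighb (inj_eq (tracks_inj T)) ij /=.
apply: contra ncij; apply: (inj_preserved_reflected (tracks_inj T)) => a b ab.
have [pi' T' _] := tracks_S a T.
by have [] := tracks_comm T ab T'.
Qed.

(** The braid hexagon at h is mapped to a closed walk whose consecutive labels are neighbours at
    each corner, so [hexagon] makes its labels alternate. After the full turn the labelling is again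
    [pi], because the lifted walk closes up at h' itself. *)
Lemma tracks_hexagon h h' pi i j (pi' : 'I_n -> 'I_n) : tracks h h' pi ->
  neighb i j -> tracks (swap_row i h) (swap_row (pi i) h') pi' -> pi' j = pi j.
Proof.
move=> T0 ij T1'.
have [p1 T1 E1] := tracks_S i T0; have [p2 T2 E2] := tracks_S j T1.
have [p3 T3 E3] := tracks_S i T2; have [p4 T4 E4] := tracks_S j T3.
have [p5 T5 E5] := tracks_S i T4; have [p6 T6 E6] := tracks_S j T5.
have N0 := tracks_neighb T0 ij; have N1 := tracks_neighb T1 ij.
have N2 := tracks_neighb T2 ij; have N3 := tracks_neighb T3 ij.
have N4 := tracks_neighb T4 ij; have N5 := tracks_neighb T5 ij.
have N6 := tracks_neighb T6 ij.
have hE : swap_row j (swap_row i (swap_row j (swap_row i (swap_row j (swap_row i h))))) = h.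
  apply/rowP => p; rewrite !mxE braid 1?neighb_sym // !sK //.
have [gh gh' F _] := T0.
have F6 : q (act [:: pi i; p1 j; p2 i; p3 j; p4 i; p5 j] h') = q h'.
  by case: T6 => _ _ F6 _; rewrite -F -[X in f (q X)]hE F6.
have triv : forall m, actz [:: pi i; p1 j; p2 i; p3 j; p4 i; p5 j] m = m.
  by apply: (closed_walk _ gh' F6).
have h6 : swap_row (p5 j) (swap_row (p4 i) (swap_row (p3 j) (swap_row (p2 i) (swap_row (p1 j) (swap_row (pi i) h'))))) = h'.
  by apply/rowP => p; rewrite -[RHS]triv -actE.
rewrite hE h6 in T6; have E60 := tracks_eq T6 T0.
(* The word is rotated to start at [p5 j], so that its first and third letters are [p5 j], which
   equals [pi j], and [p1 j], which equals [pi' j]. *)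
have {}triv := actz_rot1 (actz_rot1 (actz_rot1 (actz_rot1 (actz_rot1 triv)))).
have H := hexagon _ _ _ _ _ _ triv.
rewrite (tracks_eq T1' T1) -E60 E6; apply: H.
- by rewrite -E6 -E60 neighb_sym.
- by rewrite -E1.
- by rewrite -E2 neighb_sym.
- by rewrite -E3.
- by rewrite -E4 neighb_sym.
- by rewrite -E5.
Qed.

Lemma tracks_next h h' pi i : tracks h h' pi -> tracks (swap_row i h) (swap_row (pi i) h') pi.
Proof.
move=> T; have [pi' T' E'] := tracks_S i T.
have E : pi' =1 pi.
  move=> j; have [<- //|ij] := eqVneq i j.
  case: (boolP (comm i j)) => cij; first by have [] := tracks_comm T cij T'.
  by apply: (tracks_hexagon T _ T'); rewrite /neighb ij.
by case: T' => g1 g2 F H; split=> // j; rewrite H E.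
Qed.

Lemma tracks_act h h' pi w : tracks h h' pi ->
  f (q (act w h)) = q (act (map pi w) h').
Proof.
elim: w h h' => [|i w IH] h h' T /=; first by case: T.
by rewrite (IH _ _ (tracks_next i T)).
Qed.

End Rigidity.

(** * The index of the lattice *)

Section Index.
Variables (e k : nat).
Local Notation n := e.+3.
Local Notation vec := 'rV[int]_n.
Implicit Types (i j p : 'I_n) (h b v : vec).
Local Notation M := (Mmat (fun _ : 'I_n => k)).
Local Notation inL := (@inL e k).
Hypothesis k_gt0 : (0 < k)%N.

Definition lattice_index := (k.+1 ^ n - k ^ n)%N.

Definition psi (t : nat) := (k.+1 ^ t * k ^ (n - t))%N.

Lemma psi_lt t u : (t < u <= n)%N -> (psi t < psi u)%N.
Proof.
case/andP; elim: u => // u IH; rewrite ltnS => tu un.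
have step : (psi u < psi u.+1)%N.
  rewrite /psi -(subnSK un) expnS mulnCA [(k.+1 ^ u.+1)%N]expnS -mulnA.
  by rewrite ltn_pmul2r // muln_gt0 !expn_gt0 k_gt0.
move: tu; rewrite leq_eqVlt => /orP[/eqP -> //|tu].
by apply: ltn_trans step; apply: IH => //; exact: ltnW.
Qed.

Lemma psi_ends : (psi n - psi 0 = lattice_index)%N.
Proof. by rewrite /psi subnn subn0 !expn0 muln1 mul1n. Qed.

Lemma psi_le t u : (t <= u <= n)%N -> (psi t <= psi u)%N.
Proof.
case/andP; rewrite leq_eqVlt => /orP[/eqP -> //|tu] un.
by apply/ltnW/psi_lt; rewrite tu un.
Qed.

Lemma index_gt0 : (0 < lattice_index)%N.
Proof. by rewrite -psi_ends subn_gt0 psi_lt ?leqnn. Qed.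

(* Modulo [lattice_index] the functional sends the i-th basis vector to
   k^(n-1) ((k+1)/k)^i, so it kills the lattice. *)
Definition phi (v : vec) : int :=
  \sum_j v 0 j * (k.+1 ^ j * k ^ (e.+2 - j))%N%:Z.

Lemma weight_succ j : (k.+1 * (k.+1 ^ j * k ^ (e.+2 - j)) = psi j.+1)%N.
Proof. by rewrite /psi expnS mulnA subSS. Qed.

Lemma weight_mul j : (k * (k.+1 ^ j * k ^ (e.+2 - j)) = psi j)%N.
Proof. by rewrite /psi mulnCA -expnS -subSn // -ltnS. Qed.

Lemma val_N1 : val (-1 : 'I_n) = e.+2. Proof. by rewrite /= !modn_small. Qed.

(** Both nonzero entries of row j contribute [psi (j + 1)] with opposite signs, except in the last
    row: its second entry wraps around to column 0 and leaves [psi n - psi 0]. *)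
Lemma phi_mulM b : phi (b *m M) = b 0 (-1) * lattice_index%:Z.
Proof.
rewrite /phi; under eq_bigr do rewrite mulME mulrBl mulrAC -[_ * b 0 (_ - 1) * _]mulrAC
  -!PoszM weight_succ weight_mul.
rewrite sumrB [X in _ - X](reindex_inj (addIr 1)) -sumrB.
under eq_bigr do rewrite addrK -mulrBl mulrC.
rewrite (bigD1 (-1)) // big1 ?addr0.
  have lt0 : (psi 0 < psi n)%N by rewrite psi_lt ?leqnn.
  by rewrite [nat_of_ord _]val_N1 addNr /= subzn 1?ltnW // psi_ends addr0.
move=> j jN; rewrite val_addr1 ?subrr ?mulr0 //.
by rewrite addr_eq0.
Qed.

Lemma inL_phi v : inL v -> (lattice_index%:Z %| phi v)%Z.
Proof. by case=> b ->; rewrite phi_mulM dvdz_mull. Qed.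

(** The values of [psi] increase strictly over an interval of length exactly [lattice_index], so
    only its two ends can be congruent. *)
Lemma psi_congr (t u : nat) : (0 < t <= n)%N -> (u < n)%N ->
  (lattice_index%:Z %| (psi t)%:Z - (psi u)%:Z)%Z -> t = u \/ (t = n /\ u = 0%N).
Proof.
case/andP=> t0 tn un; case: (ltngtP t u) => [tu|ut|->]; last by left.
  have lt1 : (psi t < psi u)%N by rewrite psi_lt // tu ltnW.
  have lt2 : (psi u < psi n)%N by rewrite psi_lt // un leqnn.
  have lt3 : (psi 0 < psi t)%N by rewrite psi_lt // t0.
  have E := psi_ends; rewrite -opprB subzn 1?ltnW // dvdzE abszN /=.
  by move/dvdn_leq; rewrite subn_gt0 lt1 => /(_ isT); lia.
have lt1 : (psi u < psi t)%N by rewrite psi_lt // ut.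
rewrite subzn 1?ltnW // dvdzE /= => /dvdn_leq; rewrite subn_gt0 lt1 => /(_ isT) H.
right; have E := psi_ends; have p0n : (psi 0 < psi n)%N by rewrite psi_lt ?leqnn.
split.
  apply/eqP; rewrite eqn_leq tn leqNgt; apply/negP => tn'.
  have lt2 : (psi t < psi n)%N by rewrite psi_lt // tn' leqnn.
  have le0 : (psi 0 <= psi u)%N by apply: psi_le; rewrite /= ltnW.
  lia.
apply/eqP; rewrite -leqn0 leqNgt; apply/negP => u0.
have lt2 : (psi 0 < psi u)%N by rewrite psi_lt // u0 ltnW.
have le0 : (psi t <= psi n)%N by rewrite psi_le // tn leqnn.
lia.
Qed.

Lemma phi_delta p : phi (delta_mx 0 p) = (k.+1 ^ p * k ^ (e.+2 - p))%N%:Z.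
Proof.
rewrite /phi (bigD1 p) //= big1; first by rewrite !mxE !eqxx mul1r addr0.
by move=> j jp; rewrite !mxE (negbTE jp) mul0r.
Qed.

Lemma phiD u v : phi (u + v) = phi u + phi v.
Proof. by rewrite /phi -big_split /=; apply: eq_bigr => j _; rewrite !mxE mulrDl. Qed.

Lemma phiZ (c : int) v : phi (c *: v) = c * phi v.
Proof. by rewrite /phi mulr_sumr; apply: eq_bigr => j _; rewrite !mxE mulrA. Qed.

(** This recovers the cyclic order of the coordinates from the lattice alone. *)
Lemma phi_cong p r : inL (k.+1%:Z *: delta_mx 0 p - k%:Z *: delta_mx 0 r) -> r = p + 1.
Proof.
move/inL_phi; rewrite -scaleNr phiD !phiZ !phi_delta mulNr -!PoszM.
rewrite weight_succ weight_mul => /psi_congr H.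
have [E|[E r0]] := H (ltn_ord p) (ltn_ord r).
  apply/val_inj; rewrite /= -E modnDmr addn1 modn_small // E; exact: ltn_ord.
by apply/val_inj; rewrite /= r0 modnDmr addn1 E modnn.
Qed.

Lemma row_gen p : inL (k.+1%:Z *: delta_mx 0 p - k%:Z *: delta_mx 0 (p + 1)).
Proof.
exists (delta_mx 0 p); apply/rowP => j; rewrite mulME !mxE /=.
by rewrite subr_eq.
Qed.

(** A row of M is sent to a vector of the same shape with permuted indices; [phi_cong] says that
    these indices are again consecutive. *)
Lemma perm_preserving_lattice (sg : 'I_n -> 'I_n) : injective sg ->
  (forall l, inL l -> inL (\row_j l 0 (sg j))) ->
  forall j, sg (j + 1) = sg j + 1.
Proof.
move=> sgI pres; have [tau K1 K2] := injF_bij sgI.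
have D p : \row_j ((delta_mx 0 p : vec) 0 (sg j)) = delta_mx 0 (tau p).
  by apply/rowP => j; rewrite !mxE /= (can2_eq K1 K2).
have T p : tau (p + 1) = tau p + 1.
  apply: phi_cong; have := pres _ (row_gen p); congr (inL _).
  by rewrite -!D; apply/rowP => j; rewrite !mxE.
by move=> j; apply: (can_inj K2); rewrite T !K1.
Qed.

(** Modulo the lattice, (k+1) e_p = k e_(p+1). Iterating this once around the cycle, at t = n, gives
    [index_kills]. *)
Lemma delta_chain p (t : nat) :
  inL ((k.+1 ^ t)%N%:Z *: delta_mx 0 p - (k ^ t)%N%:Z *: delta_mx 0 (p + t%:R)).
Proof.
elim: t => [|t IH]; first by rewrite !expn0 addr0 subrr; exact: inL0.
have := inLD (inLZ k.+1%:Z IH) (inLZ (k ^ t)%N%:Z (row_gen (p + t%:R))).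
congr (inL _); apply/rowP => j; rewrite !mxE !expnS !PoszM -natr1 addrA /=.
move: (k.+1 ^ t)%N (k ^ t)%N => A B.
by case: (j == p); case: (j == p + t%:R); case: (j == p + t%:R + 1) => /=; lia.
Qed.

Lemma index_kills p : inL (lattice_index%:Z *: delta_mx 0 p).
Proof.
have := delta_chain p n; have -> : (n%:R : 'I_n) = 0.
  by apply/eqP; rewrite pmulrn res_eq0 dvdzz.
by rewrite addr0 -scalerBl subzn // leq_exp2r.
Qed.

(** A common divisor of k and the index divides (k+1)^n, which is coprime to k. *)
Lemma coprime_index : coprime k lattice_index.
Proof.
have lt : (k ^ n < k.+1 ^ n)%N by rewrite ltn_exp2r.
rewrite /coprime -dvdn1; set g := gcdn _ _.
have gk : (g %| k)%N by exact: dvdn_gcdl.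
have gi : (g %| lattice_index)%N by exact: dvdn_gcdr.
have : (g %| k.+1 ^ n)%N.
  by rewrite -(subnK (ltnW lt)) dvdn_add // dvdn_exp.
have co : coprime g k.+1 by rewrite (coprime_dvdl gk) // coprimenS.
by move=> /gcdn_idPl gX; move: (coprimeXr n co); rewrite /coprime gX => /eqP ->.
Qed.

(** k is invertible modulo the index, which kills the quotient, so e_(j+1) is a multiple of e_j
    there; u is the inverse of k. *)
Lemma delta_cyclic j : exists a : int, inL (delta_mx 0 j - a *: delta_mx 0 0).
Proof.
elim/ord_cyc_ind: j => [|j [a La]].
  by exists 1; rewrite scale1r subrr; exact: inL0.
have [u [v uv]] := Bezoutz k lattice_index.
have {}uv : u * k%:Z + v * lattice_index%:Z = 1.
  by rewrite uv /gcdz !absz_nat (eqP coprime_index).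
exists (u * k.+1%:Z * a).
have := inLD (inLZ (u * k.+1%:Z) La)
  (inLB (inLZ v (index_kills (j + 1))) (inLZ u (row_gen j))).
congr (inL _); apply/rowP => i; rewrite !mxE /=; move: uv; move: lattice_index => N.
by case: (i == j + 1); case: (i == j); case: (i == 0) => /=; lia.
Qed.

Lemma quotient_cyclic v : exists a : 'I_lattice_index, inL (v - (a : nat)%:Z *: delta_mx 0 0).
Proof.
have [c Lc] : exists c : int, inL (v - c *: delta_mx 0 0).
  have [a aP] := choice delta_cyclic.
  exists (\sum_j v 0 j * a j).
  rewrite [v in v - _]row_sum_delta scaler_suml -sumrB.
  apply: (big_ind inL) => [||j _]; [exact: inL0 | exact: inLD |].
  by rewrite -scalerA -scalerBr; exact: inLZ.
have N0 : lattice_index%:Z != 0 by rewrite eqz_nat -lt0n index_gt0.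
have lt : (`|(c %% lattice_index)%Z| < lattice_index)%N.
  by rewrite -ltz_nat gez0_abs ?modz_ge0 // ltz_pmod // ltz_nat index_gt0.
exists (Ordinal lt); rewrite /= gez0_abs ?modz_ge0 //.
have := inLD Lc (inLZ (c %/ lattice_index)%Z (index_kills 0)).
congr (inL _); rewrite {1}(divz_eq c lattice_index) scalerDl scalerA opprD addrA addrAC.
by rewrite subrK.
Qed.

(** [phi] sends the generator e_0 to k^(n-1), a unit modulo the index, so no smaller multiple of e_0
    vanishes. *)
Lemma quotient_cyclic_inj (a b : 'I_lattice_index) :
  inL ((a : nat)%:Z *: delta_mx 0 0 - (b : nat)%:Z *: delta_mx 0 0) -> a = b.
Proof.
rewrite -scalerBl => /inL_phi; rewrite phiZ phi_delta expn0 mul1n Gauss_dvdzl; last first.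
  by rewrite /coprimez /gcdz !absz_nat; apply/eqP/eqP/coprimeXr; rewrite coprime_sym coprime_index.
move=> /dvdzP[c E]; apply/val_inj => /=.
move: (ltn_ord a) (ltn_ord b) E; move: (nat_of_ord a) (nat_of_ord b) => x y.
move: lattice_index => N xN yN E.
have [c0|[c1|c1]] : c = 0 \/ 1 <= c \/ c <= -1 by lia.
- by move: E; rewrite c0 mul0r; lia.
- have : 0 <= (c - 1) * N%:Z by apply: mulr_ge0; lia.
  by lia.
- have : 0 <= (- 1 - c) * N%:Z by apply: mulr_ge0; lia.
  by lia.
Qed.

(** Column 0 has nonzero entries only in the first and last rows. The two minors are triangular,
    with constant diagonals k + 1 and - k. *)
Lemma det_Mmat : \det M = lattice_index%:Z.
Proof.
have E i j : M i j = if j == i then k.+1%:Z else if j == i + 1 then - k%:Z else 0.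
  by rewrite mxE ordSE.
have vS (x : 'I_n) : val (x + 1) = ((val x).+1 %% n)%N by rewrite /= modnDmr addn1.
have v0 (x : 'I_n.-1) : val (lift (0 : 'I_n) x) = x.+1 by exact: lift0.
have vN (x : 'I_n.-1) : val (lift (ord_max : 'I_n) x) = x by exact: lift_max.
rewrite (expand_det_col _ 0) (bigD1 (0 : 'I_n)) // (bigD1 (-1 : 'I_n)) //.
rewrite big1 => [|i /andP[/= i0 iN]]; last first.
  by rewrite E eq_sym (negbTE i0) eq_sym addr_eq0 (negbTE iN) mul0r.
have NE : (-1 : 'I_n) = ord_max by apply/val_inj; rewrite val_N1.
rewrite !E eqxx addNr eqxx NE /= addr0 /cofactor -[X in _ * (_ * X) + _]det_tr.
rewrite !det_trig.
- have -> : \prod_(i < n.-1) (row' 0 (col' 0 M))^T i i = k.+1%:Z ^+ n.-1.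
    rewrite -[in RHS](card_ord n.-1) -prodr_const; apply: eq_bigr => i _.
    by rewrite !mxE eqxx.
  have -> : \prod_(i < n.-1) row' ord_max (col' 0 M) i i = (- k%:Z) ^+ n.-1.
    rewrite -[in RHS](card_ord n.-1) -prodr_const; apply: eq_bigr => i _.
    have lt : (i.+1 < n)%N := ltn_ord i.
    rewrite 2!mxE E -!val_eqE vS v0 vN modn_small //.
    by rewrite eqxx ifN // neq_ltn ltnSn orbT.
  rewrite expr0 mul1r -exprS addn0 -exprMn mulN1r opprK mulNr -exprS.
  by rewrite /lattice_index -subzn ?leq_exp2r // -!natz !natrX !natz.
- apply/is_trig_mxP => i j ij; rewrite 2!mxE E -!val_eqE vS v0 vN.
  have lt : (i.+1 < n)%N := ltn_ord i; rewrite modn_small // !ifN //.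
    by rewrite eqSS neq_ltn ij orbT.
  by rewrite neq_ltn ltnS (ltnW ij) orbT.
- apply/is_trig_mxP => i j ij; rewrite 3!mxE E -!val_eqE vS !v0 !ifN //.
    have : (j.+1 < n)%N := ltn_ord j; rewrite leq_eqVlt => /orP[/eqP jn|lt].
      by rewrite jn modnn.
    by rewrite modn_small // eqSS neq_ltn ltnS (ltnW ij).
  by rewrite eqSS neq_ltn ij.
- by rewrite /= oppr_eq0 oner_eq0.
Qed.

End Index.

(** * Signed permutations with translation, acting on generic rows *)

Section ModelMaps.
Variable e : nat.
Local Notation n := e.+3.
Local Notation vec := 'rV[int]_n.
Implicit Types (i j p : 'I_n) (h v : vec).

Definition base : vec := \row_j (j : nat)%:Z.

Lemma gen_base : gen base.
Proof. by move=> i j /=; rewrite !mxE -!pmulrn !natr_Zp. Qed.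

Lemma gen_addc h (c : int) : gen h -> gen (h + const_mx c).
Proof. by move=> gh i j /=; rewrite !mxE !intrD => /addIr /gh. Qed.

Lemma gen_addZ h v : gen h -> gen (h + n%:Z *: v).
Proof. by move=> gh i j /=; rewrite !mxE !intrD !res_mulr !addr0 => /gh. Qed.

Lemma gen_opp h : gen h -> gen (- h).
Proof. by move=> gh i j /=; rewrite !mxE !intrN => /oppr_inj /gh. Qed.

Lemma gen_perm h (sg : 'I_n -> 'I_n) : injective sg -> gen h ->
  gen (\row_j h 0 (sg j)).
Proof. by move=> sI gh i j /=; rewrite !mxE => /gh /sI. Qed.

Definition signed_map (b : bool) (sg : 'I_n -> 'I_n) v h : vec :=
  (-1) ^+ b *: (\row_j h 0 (sg j) + n%:Z *: v).

Lemma gen_ymap b sg v h : injective sg -> gen h -> gen (signed_map b sg v h).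
Proof.
move=> sI gh; have g1 : gen (\row_j h 0 (sg j) + n%:Z *: v).
  by apply/gen_addZ/gen_perm.
by case: b; rewrite /signed_map ?expr1 ?expr0 ?scaleN1r ?scale1r //; exact: gen_opp.
Qed.

(** Each row takes every residue exactly once: matching residues gives [sg], and the quotients by n
    give v. *)
Lemma gen_related h h1 : gen h -> gen h1 ->
  exists2 sg : 'I_n -> 'I_n, injective sg &
  exists v, h1 = \row_j h 0 (sg j) + n%:Z *: v.
Proof.
move=> gh gh1.
have rel j : exists pa : 'I_n * int, h1 0 j = h 0 pa.1 + n%:Z * pa.2.
  have [p hp] := gen_surj (h1 0 j)%:~R gh.
  by have /eqP := esym hp; move=> /res_eqP [a E]; exists (p, a).
have [F FP] := choice rel; exists (fun j => (F j).1).
  move=> i j ij; apply: gh1; rewrite /= !FP ij !intrD !res_mulr //.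
by exists (\row_j (F j).2); apply/rowP => j; rewrite !mxE FP.
Qed.

(** Swaps act on values and ignore multiples of n, while [sg] acts on positions. *)
Lemma act_perm_shift w h (sg : 'I_n -> 'I_n) v :
  act w (\row_j h 0 (sg j) + n%:Z *: v) = \row_j act w h 0 (sg j) + n%:Z *: v.
Proof. by apply/rowP => j; rewrite !(actE, mxE) actz_mod. Qed.

Lemma act_addc w h (c : int) :
  act [seq i + c%:~R | i <- w] (h + const_mx c) = act w h + const_mx c.
Proof.
elim: w h => [//|i w IH] h /=; rewrite -IH; congr act.
by apply/rowP => j; rewrite !mxE s_shift addrK.
Qed.

Lemma act_opp w h : act [seq - i - 1 | i <- w] (- h) = - act w h.
Proof.
elim: w h => [//|i w IH] h /=; rewrite -IH; congr act.
by apply/rowP => j; rewrite !mxE s_opp opprD !opprK addrK.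
Qed.

End ModelMaps.

(** * The form of an arbitrary automorphism *)

Section AutomorphismForm.
Variables (e k : nat).
Local Notation n := e.+3.
Local Notation vec := 'rV[int]_n.
Implicit Types (i j p : 'I_n) (h : vec) (w : seq 'I_n).
Hypothesis large : ((0 < k) && ((0 < e) || (1 < k)))%N.
Local Notation eqv := (eqv k).
Local Notation inL := (inL k).

Variables (V : Type) (adj : V -> V -> Prop) (q : vec -> V).
Hypothesis q_surj : forall u, exists2 h, gen h & q h = u.
Hypothesis q_eq : forall h h', gen h -> gen h' -> (q h = q h' <-> eqv h h').
Hypothesis q_adj : forall h h', gen h -> gen h' ->
  (adj (q h) (q h') <-> exists i, eqv h' (swap_row i h)).

Lemma q_addc h (c : int) : gen h -> q (h + const_mx c) = q h.
Proof.
move=> gh; apply/esym/q_eq => //; [exact: gen_addc | exact: eqv_addc].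
Qed.

Lemma aut_perm_form f : automorphisms adj f ->
  exists b, exists2 sg : 'I_n -> 'I_n, injective sg &
  exists v, forall h, gen h -> f (q h) = q (signed_map b sg v h).
Proof.
move=> fA; have gb := @gen_base e.
have [h' gh' E'] := q_surj (f (q (base e))).
have [pi T] := tracks_exists q_surj q_eq q_adj fA gb gh' (esym E').
have A w := tracks_act large q_surj q_eq q_adj fA w T.
have [c pic _] := dihedral (tracks_inj large q_eq fA T)
  (fun i j => tracks_neighb large q_surj q_eq q_adj fA T).
have [b [h1 gh1 B]] : exists b : bool, exists2 h1, gen h1 &
    forall w, f (q (act w (base e))) = q ((-1) ^+ b *: act w h1).
  (* The dihedral action on labels is absorbed into the representative of the image of the base
     vertex: adding a constant rotates labels, negation reflects them. *)
  pose z : int := (c : nat); have zc : z%:~R = c by rewrite -pmulrn natr_Zp.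
  case: pic => pic.
    exists false, (h' + const_mx (- z)); first exact: gen_addc.
    move=> w; rewrite A expr0 scale1r -[in RHS](@q_addc _ z); last exact/gen_act/gen_addc.
    rewrite -act_addc; congr (q (act _ _)); first by apply: eq_map => i; rewrite pic zc.
    by apply/rowP => j; rewrite !mxE addrNK.
  (* Negation turns the label i into - i - 1, hence the shift by z + 1 instead of z. *)
  exists true, (- (h' + const_mx (- (z + 1)))); first exact/gen_opp/gen_addc.
  move=> w; rewrite A expr1 scaleN1r -act_opp opprK.
  rewrite -[in RHS](@q_addc _ (z + 1)); last exact/gen_act/gen_addc.
  rewrite -act_addc; congr (q (act _ _)); last first.
    by apply/rowP => j; rewrite !mxE addrNK.
  by rewrite -map_comp; apply: eq_map => i /=; rewrite pic intrD zc [c + _]addrC addrA addrNK.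
have [sg sgI [v vE]] := gen_related gb gh1.
exists b, sg => //; exists v => h gh; have [w [c' hE]] := connected gb gh.
have gw := @gen_act _ w _ gb.
rewrite {1}hE q_addc // B vE act_perm_shift -/(signed_map b sg v (act w (base e))).
rewrite -(@q_addc _ ((-1) ^+ b * c')); last exact: gen_ymap.
congr q; rewrite hE /signed_map; apply/rowP => j; rewrite !mxE.
by rewrite -mulrDr addrAC.
Qed.

Lemma aut_form f : automorphisms adj f ->
  exists b c v, forall h, gen h -> f (q h) = q (signed_map b (fun j => j - c) v h).
Proof.
move=> fA; have [b [sg sgI [v fE]]] := aut_perm_form fA.
have gb := @gen_base e.
have step : forall j, sg (j + 1) = sg j + 1.
  apply: (@perm_preserving_lattice e k) => //; first by case/andP: large.
  (* [base] and [base + n l] represent the same vertex, so their images do too; the comparison puts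
     the permuted l in the lattice up to a constant row, which lies in the lattice as well. *)
  move=> l Ll; have gl := @gen_addZ _ _ l gb.
  have : q (base e + n%:Z *: l) = q (base e).
    by apply/esym/q_eq => //; exact: eqv_addL.
  move=> /(congr1 f); rewrite !fE //.
  move=> /q_eq -/(_ (@gen_ymap _ b _ v _ sgI gl) (@gen_ymap _ b _ v _ sgI gb)).
  case=> c [l' Ll' E].
  have {}E j : n%:Z * (l 0 (sg j) + (-1) ^+ b * l' 0 j) = - ((-1) ^+ b * c).
    move/rowP/(_ j): E; rewrite !mxE.
    case: b {fE} => /=; rewrite ?expr1 ?expr0 ?mulN1r ?mul1r; lia.
  have -> : \row_j l 0 (sg j) =
      const_mx (l 0 (sg 0) + (-1) ^+ b * l' 0 0) - (-1) ^+ b *: l'.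
    apply/rowP => j; rewrite !mxE; have := E j; rewrite -(E 0).
    by move/(mulfI (_ : n%:Z != 0)) => /(_ isT) <-; rewrite addrK.
  by apply: inLB; [exact: inL_const | exact: inLZ].
have sgE j : sg j = j + sg 0.
  by elim/ord_cyc_ind: j => [|j IH]; rewrite ?add0r // step IH addrAC.
exists b, (- sg 0), v => h gh; rewrite fE //; congr q.
by rewrite /signed_map; congr (_ *: (_ + _)); apply/rowP => j; rewrite !mxE opprK -sgE.
Qed.

End AutomorphismForm.

(** * Faces of the arrangement *)

Section Geometry.
Variables (R : realType) (d : nat).
Local Notation E := 'rV[R]_d.+1.
Local Notation V := (@hyp_space R d).
Implicit Types (x y z : E) (i j p q : 'I_d.+1).

Definition floor_diff x i j : int := Num.floor (x 0 j - x 0 i).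

(** The pairs are ordered, so lower bounds for (j, i) act as upper bounds for (i, j), and one family
    of floor inequalities describes a closed face. *)
Definition closed_cell x : set E :=
  [set y | hyp_space y /\ forall i j, floor_diff x i j <= floor_diff y i j].

Lemma D_geP x i j (m : int) : (m <= floor_diff x i j) = (m%:~R <= x 0 j - x 0 i).
Proof. by rewrite /floor_diff floor_ge_int ?num_real. Qed.

Lemma P_refl x : hyp_space x -> closed_cell x x.
Proof. by []. Qed.

Lemma P_trans x y z : closed_cell z y -> closed_cell y x -> closed_cell z x.
Proof. by case=> _ zy [Vx yx]; split=> // i j; apply: le_trans (zy i j) (yx i j). Qed.

Lemma P_hyp x y : closed_cell x y -> hyp_space y. Proof. by case. Qed.

Lemma P_subset x y : hyp_space x -> (closed_cell x `<=` closed_cell y <-> closed_cell y x).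
Proof.
move=> Vx; split=> [sub|yx z]; first exact/sub/P_refl.
exact: P_trans.
Qed.

Lemma P_eq x y : hyp_space x -> hyp_space y ->
  (closed_cell x = closed_cell y <-> forall i j, floor_diff x i j = floor_diff y i j).
Proof.
move=> Vx Vy; split=> [E i j|E].
  have [_ H1] : closed_cell x y by rewrite E; exact: P_refl.
  have [_ H2] : closed_cell y x by rewrite -E; exact: P_refl.
  by apply/eqP; rewrite eq_le H1 H2.
by apply/seteqP; split=> z [Vz H]; split=> // i j; [rewrite -E | rewrite E].
Qed.

Lemma coord_diff_continuous i j : continuous (fun y : E => y 0 j - y 0 i).
Proof.
move=> y; have F : Filter (nbhs (y : E)) by exact: (@nbhs_filter E y).
apply: (@cvgB R R E (nbhs y) F).
  exact: (@coord_continuous R 1 d.+1 0 j y).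
exact: (@coord_continuous R 1 d.+1 0 i y).
Qed.

Lemma hyp_space_closed : closed (@hyp_space R d).
Proof.
have -> : V = (fun x : E => \sum_i x 0 i) @^-1` [set 0] by [].
apply: closed_comp; last exact: closed_eq.
move=> x _; have F : Filter (nbhs (x : E)) by exact: (@nbhs_filter E x).
apply: (@cvg_big R _ _ _ _ _ E (nbhs (x : E)) _ (fun i (y : E) => y 0 i) (fun i => x 0 i) F).
  exact: add_continuous.
by move=> i _; exact: (@coord_continuous R 1 d.+1 0 i x).
Qed.

Lemma P_closed x : closed (closed_cell x).
Proof.
have -> : closed_cell x = V `&` \bigcap_(ij in @setT ('I_d.+1 * 'I_d.+1))
    (fun y : E => y 0 ij.2 - y 0 ij.1) @^-1` [set r | (floor_diff x ij.1 ij.2)%:~R <= r].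
  apply/seteqP; split=> y [Vy H]; split=> //.
    by case=> i j _ /=; rewrite -D_geP.
  move=> i j.
  by have := H (i, j) Logic.I; rewrite /= -D_geP.
apply: closedI; first exact: hyp_space_closed.
apply: closed_bigI => -[i j] _ /=.
apply: closed_comp; last exact: closed_ge.
by move=> y _; exact: coord_diff_continuous.
Qed.

Lemma P_ge x y i j (m : int) : closed_cell x y ->
  m%:~R <= x 0 j - x 0 i -> m%:~R <= y 0 j - y 0 i.
Proof. by case=> _ H; rewrite -!D_geP => /le_trans; apply. Qed.

Lemma cell_sub_P x : cell x `<=` closed_cell x.
Proof.
have sg_ge (a b : R) : Num.sg a = Num.sg b -> (0 <= a) = (0 <= b).
  by move=> E; rewrite -sgr_ge0 E sgr_ge0.
have sg_le (a b : R) : Num.sg a = Num.sg b -> (a <= 0) = (b <= 0).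
  by move=> E; rewrite -sgr_le0 E sgr_le0.
move=> y [Vy H]; split=> // i j; rewrite D_geP.
have := floor_le (x 0 j - x 0 i).
rewrite -/(floor_diff x i j); set m := floor_diff x i j => mx.
case: (ltngtP i j) => ij.
- by have := sg_ge _ _ (H i j m ij); rewrite !subr_ge0 => ->.
- have := sg_le _ _ (H j i (- m) ij); rewrite mulrNz !opprK => E.
  have : y 0 i - y 0 j + m%:~R <= 0 by rewrite E; lra.
  by lra.
- by have := val_inj ij => {}ij; subst j; move: mx; rewrite !subrr.
Qed.

(** A point y of the closed cell is the limit of points moved slightly towards x. These lie in the
    open cell: whenever x is strictly on one side of a hyperplane, y is on that side or on the
    hyperplane. *)
Lemma cell_P x : hyp_space x -> closure (cell x) = closed_cell x.
Proof.
move=> Vx; apply/seteqP; split.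
  rewrite [X in _ `<=` X](closure_id _).1; last exact: P_closed.
  exact/closure_subset/cell_sub_P.
move=> y Py B By.
have cv : (fun t : R => y + t *: (x - y)) @ (0 : R)^'+ --> y.
  rewrite -[X in _ --> X]addr0 -(scale0r (x - y)).
  apply: cvg_at_right_filter.
  apply: cvgD; first exact: cvg_cst.
  by apply: cvgZr_tmp; exact: cvg_id.
have : \forall t \near (0 : R)^'+, [/\ 0 < t, t < 1 & B (y + t *: (x - y))].
  near=> t; split; first by near: t; exact: nbhs_right_gt.
    by near: t; exact: nbhs_right_lt.
  by near: t; exact: cv.
move=> /filter_ex [t [t0 t1 Bt]]; exists (y + t *: (x - y)); split=> //.
have [Vy _] := Py; split.
  rewrite /hyp_space /=; under eq_bigr do rewrite !mxE.
  move: Vx Vy; rewrite /hyp_space /= => Vx Vy.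
  by rewrite big_split /= -mulr_sumr sumrB Vx Vy subrr mulr0 addr0.
move=> i j m _; rewrite !mxE.
have G1 := @P_ge x y i j m Py.
have G2 := @P_ge x y j i (- m) Py; rewrite mulrNz in G2.
have -> : y 0 j + t * (x 0 j - y 0 j) - (y 0 i + t * (x 0 i - y 0 i)) - m%:~R =
   (1 - t) * (y 0 j - y 0 i - m%:~R) + t * (x 0 j - x 0 i - m%:~R) by lra.
have [lt|gt|eq] := ltgtP (x 0 j - x 0 i - m%:~R) 0.
- rewrite (ltr0_sg lt); apply: ltr0_sg.
  have b0 : y 0 j - y 0 i - m%:~R <= 0 by have := G2; lra.
  have : (1 - t) * (y 0 j - y 0 i - m%:~R) <= 0 by apply: mulr_ge0_le0; lra.
  have : t * (x 0 j - x 0 i - m%:~R) < 0 by rewrite pmulr_rlt0.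
  lra.
- rewrite (gtr0_sg gt); apply: gtr0_sg.
  have b0 : 0 <= y 0 j - y 0 i - m%:~R by have := G1; lra.
  have : 0 <= (1 - t) * (y 0 j - y 0 i - m%:~R) by apply: mulr_ge0; lra.
  have : 0 < t * (x 0 j - x 0 i - m%:~R) by rewrite pmulr_rgt0.
  lra.
- have b0 : y 0 j - y 0 i - m%:~R = 0 by have := G1; have := G2; lra.
  by rewrite eq b0 !mulr0 addr0.
Unshelve. all: by end_near.
Qed.

End Geometry.


Lemma floor_add_neg (R : archiRealFieldType) (r : R) (a b : int) :
  a = Num.floor r -> b = Num.floor (- r) -> a + b = 0 -> r = a%:~R.
Proof.
move=> -> -> E; have H1 := floor_le r; have H2 := floor_le (- r).
have -> : Num.floor r = - Num.floor (- r) by lia.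
apply/eqP; rewrite eq_le; apply/andP; split; first by rewrite mulrNz; lra.
by have -> : - Num.floor (- r) = Num.floor r by lia.
Qed.

(** * Lattice points and vertices of faces *)

Section Points.
Variables (R : realType) (d : nat).
Local Notation E := 'rV[R]_d.+1.
Local Notation V := (@hyp_space R d).
Local Notation wtc := (@wt_comb R d).
Local Notation zvec := 'rV[int]_d.+1.
Implicit Types (x y z : E) (a b : zvec) (i j p q : 'I_d.+1).

Lemma sigma_faceP (F : set E) : sigma_face F <-> exists2 x, V x & F = closed_cell x.
Proof. by split=> -[x Vx ->]; exists x => //; rewrite cell_P. Qed.

Lemma wt_combE a i :
  (wtc a) 0 i = (a 0 i)%:~R - d.+1%:R^-1 * (\sum_j a 0 j)%:~R.
Proof.
have wtE p : (@wt R d p) 0 i = (p == i)%:R - d.+1%:R^-1.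
  rewrite !mxE eqxx eq_sym summxE; congr (_ - _).
  rewrite (bigD1 i) //= big1 ?addr0 => [|j ji]; first by rewrite !mxE !eqxx mulr1.
  by rewrite mxE [i == j]eq_sym (negbTE ji).
rewrite summxE; under eq_bigr => p _ do rewrite -scaler_int mxE wtE mulrBr.
rewrite sumrB (bigD1 i) //= eqxx mulr1 big1 ?addr0.
  by rewrite -mulr_suml -(raddf_sum (intmul 1)) mulrC.
by move=> p pi; rewrite (negbTE pi) mulr0.
Qed.

Lemma wt_comb_diff a i j :
  (wtc a) 0 j - (wtc a) 0 i = (a 0 j - a 0 i)%:~R.
Proof. by rewrite !wt_combE intrB opprB addrA subrK. Qed.

Lemma wt_comb_hyp a : V (wtc a).
Proof.
rewrite /hyp_space /=; under eq_bigr do rewrite wt_combE.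
rewrite sumrB sumr_const card_ord -[X in _ - X]mulr_natl mulrA mulfV ?pnatr_eq0 // mul1r.
by rewrite -(raddf_sum (intmul 1)) subrr.
Qed.

Lemma hyp_space_eq x y : V x -> V y ->
  (forall i j, x 0 j - x 0 i = y 0 j - y 0 i) -> x = y.
Proof.
move=> Vx Vy H; apply/rowP => i.
have sumE w : V w -> \sum_j (w 0 j - w 0 i) = - (d.+1%:R * w 0 i).
  by move=> Vw; rewrite sumrB [X in X - _]Vw sumr_const card_ord sub0r mulr_natl.
have : d.+1%:R * x 0 i = d.+1%:R * y 0 i.
  apply: oppr_inj; rewrite -!sumE //; exact: eq_bigr.
by move/mulfI; apply; rewrite pnatr_eq0.
Qed.

Lemma wt_comb_eqP a b :
  wtc a = wtc b <-> exists c : int, a = b + const_mx c.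
Proof.
split=> [H|[c ->]].
  exists (a 0 ord0 - b 0 ord0); apply/rowP => j; rewrite !mxE.
  have := wt_comb_diff a ord0 j; rewrite H wt_comb_diff => /intr_inj.
  by move: (a 0 j) (b 0 j) (a 0 ord0) (b 0 ord0) => w x y z; lia.
apply: hyp_space_eq; [exact: wt_comb_hyp | exact: wt_comb_hyp | move=> i j].
by rewrite !wt_comb_diff !mxE opprD addrACA subrr addr0.
Qed.

Lemma wt_combD a b : wtc (a + b) = wtc a + wtc b.
Proof.
apply/rowP => i; rewrite mxE !wt_combE mxE.
under eq_bigr do rewrite mxE.
by rewrite big_split /= !intrD mulrDr opprD addrACA.
Qed.

Lemma wt_combN a : wtc (- a) = - wtc a.
Proof.
apply/rowP => i; rewrite mxE !wt_combE mxE.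
under eq_bigr do rewrite mxE.
by rewrite sumrN !intrN mulrN opprD.
Qed.

Lemma hyp_spaceD x y : V x -> V y -> V (x + y).
Proof.
rewrite /hyp_space /= => Vx Vy; under eq_bigr do rewrite mxE.
by rewrite big_split /= Vx Vy addr0.
Qed.

Lemma hyp_spaceZ (c : R) x : V x -> V (c *: x).
Proof.
rewrite /hyp_space /= => Vx; under eq_bigr do rewrite mxE.
by rewrite -mulr_sumr Vx mulr0.
Qed.

Lemma D_wt_comb a i j : floor_diff (wtc a) i j = a 0 j - a 0 i.
Proof. by rewrite /floor_diff wt_comb_diff intrKfloor. Qed.

Lemma D_addl x a i j : floor_diff (x + wtc a) i j = floor_diff x i j + (a 0 j - a 0 i).
Proof.
rewrite /floor_diff !mxE.
have -> : x 0 j + (wtc a) 0 j - (x 0 i + (wtc a) 0 i) =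
  (x 0 j - x 0 i) + (a 0 j - a 0 i)%:~R by rewrite -wt_comb_diff; lra.
by rewrite floorDrz ?intr_int // intrKfloor.
Qed.

Lemma D_refl x i : floor_diff x i i = 0. Proof. by rewrite /floor_diff subrr floor0. Qed.

Lemma D_super x i j p : floor_diff x p i + floor_diff x i j <= floor_diff x p j.
Proof.
rewrite D_geP intrD; have := floor_le (x 0 i - x 0 p); have := floor_le (x 0 j - x 0 i).
by rewrite -/(floor_diff x p i) -/(floor_diff x i j); lra.
Qed.

Lemma D_anti x i j : floor_diff x i j + floor_diff x j i <= 0.
Proof. by have := D_super x j i i; rewrite D_refl. Qed.

Lemma D_ge_anti x i j : -1 <= floor_diff x i j + floor_diff x j i.
Proof.
have := floorD1_gt (x 0 j - x 0 i); have := floorD1_gt (x 0 i - x 0 j).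
rewrite -/(floor_diff x i j) -/(floor_diff x j i) !intrD => H1 H2.
have : 0 < ((floor_diff x i j + floor_diff x j i + 2 : int)%:~R : R) by rewrite !intrD; lra.
by rewrite ltr0z; lia.
Qed.

Lemma D_int x i j : floor_diff x i j + floor_diff x j i = 0 -> x 0 j - x 0 i = (floor_diff x i j)%:~R.
Proof. by apply: floor_add_neg => //; rewrite /floor_diff opprB. Qed.

(** The vertex obtained by rounding down all coordinates of z relative to coordinate i. Each vertex
    of the face of z arises so, possibly for several i. *)
Definition vtx z i : E := wtc (\row_j floor_diff z i j).

Lemma vtx_P z i : closed_cell z (vtx z i).
Proof.
split=> [|p q]; first exact: wt_comb_hyp.
by rewrite D_wt_comb !mxE; have := D_super z p q i; lia.
Qed.

Lemma sigma_vertexP (v : E) : sigma_face [set v] <-> exists a, v = wtc a.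
Proof.
split=> [/sigma_faceP [x Vx E]|[a ->]].
  have xv : x = v by have : [set v] x by rewrite E; exact: P_refl.
  exists (\row_j floor_diff x 0 j); have : [set v] (vtx x 0) by rewrite E; exact: vtx_P.
  by move=> <-.
apply/sigma_faceP; exists (wtc a); first exact: wt_comb_hyp.
apply/seteqP; split=> y; first by move=> ->; exact/P_refl/wt_comb_hyp.
case=> Vy H /=; apply: hyp_space_eq => // [|i j]; first exact: wt_comb_hyp.
have H1 := H i j; have H2 := H j i; rewrite !D_wt_comb in H1 H2.
have H3 := D_anti y i j; rewrite D_int ?wt_comb_diff; first by congr (_%:~R); lia.
by lia.
Qed.

Lemma vtx_complete z v : V z -> closed_cell z v -> sigma_face [set v] -> exists i, v = vtx z i.
Proof.
move=> Vz Pv /sigma_vertexP [a va].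
(* For this m, the integer v_p - v_m is at most z_p - z_m, hence at most its floor; membership in
   the closed cell gives the opposite inequality. *)
pose m := [arg min_(i < ord0 : 'I_d.+1) (z 0 i - v 0 i)]%O.
have mP j : z 0 m - v 0 m <= z 0 j - v 0 j.
  by rewrite /m; case: Order.TotalTheory.arg_minP => // i _; apply.
exists m; apply: hyp_space_eq => [||i j]; [by case: Pv | exact: wt_comb_hyp |].
have F p : v 0 p - v 0 m = (floor_diff z m p)%:~R.
  rewrite va wt_comb_diff; congr (_%:~R); apply/eqP; rewrite eq_le.
  have [_ /(_ m p)] := Pv; rewrite va D_wt_comb => ->; rewrite andbT.
  by rewrite D_geP -wt_comb_diff -va; have := mP p; lra.
rewrite /vtx wt_comb_diff !mxE intrB -!F; lra.
Qed.

Lemma vtx_eq z i j : vtx z i = vtx z j <-> floor_diff z i j + floor_diff z j i = 0.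
Proof.
split=> [/wt_comb_eqP [c E]|E].
  have Ei := congr1 (fun u : zvec => u 0 i) E.
  have Ej := congr1 (fun u : zvec => u 0 j) E.
  by move: Ei Ej; rewrite !mxE !D_refl; lia.
apply/wt_comb_eqP; exists (floor_diff z i j); apply/rowP => p; rewrite !mxE.
by have := D_super z j p i; have := D_super z i p j; lia.
Qed.

End Points.

(** * Families with exactly one repeated value *)

Lemma range_ord_card (T : Type) m (f : 'I_m -> T) : injective f ->
  range f #= `I_m.
Proof.
move=> fI; have H : [set: 'I_m] #= `I_m by rewrite card_eq_sym card_II.
by apply: (card_eq_trans _ H); apply: inj_card_eq => x y _ _; exact: fI.
Qed.

Lemma range_card_pred (T : Type) m (f : 'I_m.+1 -> T) p q : p != q -> f p = f q ->
  (forall i j, i != j -> f i = f j -> (i = p /\ j = q) \/ (i = q /\ j = p)) ->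
  range f #= `I_m.
Proof.
move=> pq fpq H; have -> : range f = range (fun i => f (lift p i)).
  apply/seteqP; split=> x [i _ <-]; last by exists (lift p i).
  have [j ->|->] := unliftP p i; first by exists j.
  by have [j qj _] := unlift_some pq; exists j => //; rewrite -qj.
apply: range_ord_card => i j E; apply/eqP/negPn/negP => ij.
have lij : lift p i != lift p j by rewrite (inj_eq lift_inj).
have [[Ep _]|[_ Ep]] := H _ _ lij E.
  by have := neq_lift p i; rewrite Ep eqxx.
by have := neq_lift p j; rewrite Ep eqxx.
Qed.

Lemma range_card_pred_inv (T : Type) m (f : 'I_m.+1 -> T) :
  range f #= `I_m ->
  exists p q, [/\ p != q, f p = f q &
  forall i j, i != j -> f i = f j -> (i = p /\ j = q) \/ (i = q /\ j = p)].
Proof.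
move=> /card_set_bijP [g [gh gi gs]].
have gm i : (g (f i) < m)%N by apply: gh; exists i.
pose h i := Ordinal (gm i).
have hE i j : h i = h j <-> f i = f j.
  split=> [/(congr1 val) /= E|E]; last by apply/val_inj; rewrite /= E.
  by apply: gi => //; rewrite inE; [exists i | exists j].
have hs (r : 'I_m) : exists i, h i = r.
  have [_ [i _ <-] E] := gs r (ltn_ord r); exists i; exact/val_inj.
have [inj|] := pselect (injective h).
  by have := leq_card h inj; rewrite !card_ord ltnn.
move=> ninj; have [p [q [pq fpq]]] : exists p q, p != q /\ f p = f q.
  apply: contrapT => no; apply: ninj => p q /hE E; apply/eqP/negPn/negP => pq.
  by apply: no; exists p, q.
exists p, q; split=> // i j ij fij.
(* If an index a outside p and q shared its value with another index, dropping both p and a would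
   leave m - 1 indices that still reach all m values. *)
have key a b : a != b -> f a = f b -> a \in [:: p; q].
  move=> ab fab; apply/negPn/negP; rewrite !inE negb_or => /andP[ap aq].
  pose A := [set~ p] :\ a.
  have surj (r : 'I_m) : exists2 c, c \in A & h c = r.
    have [c cr] := hs r.
    have [cp|cp] := eqVneq c p.
      exists q; last by rewrite -cr cp; apply/hE.
      by rewrite !inE eq_sym aq eq_sym pq.
    have [ca|ca] := eqVneq c a; last by exists c => //; rewrite !inE ca cp.
    have [bp|bp] := eqVneq b p.
      exists q; first by rewrite !inE eq_sym aq eq_sym pq.
      by rewrite -cr ca; apply/hE; rewrite fab bp.
    exists b; first by rewrite !inE eq_sym ab bp.
    by rewrite -cr ca; apply/hE.
  have le : (#|'I_m| <= #|A|)%N.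
    apply: leq_trans (leq_imset_card h A); apply/subset_leq_card/fintype.subsetP => r _.
    by have [c cA <-] := surj r; exact: imset_f.
  have := cardsC1 p; rewrite (cardsD1 a [set~ p]) !inE ap card_ord /= add1n => cA.
  by move: le; rewrite card_ord -ltnS [in X in (_ < X)%N]cA ltnn.
have := key i j ij fij; have := key j i; rewrite eq_sym => /(_ ij (esym fij)).
rewrite !inE => /orP[]/eqP Ej /orP[]/eqP Ei; move: ij; rewrite Ei Ej ?eqxx //; auto.
Qed.

(** * Alcoves and generic rows *)

Section Alcoves.
Variables (R : realType) (e : nat).
Local Notation n := e.+3.
Local Notation E := 'rV[R]_n.
Local Notation V := (@hyp_space R e.+2).
Local Notation wtc := (@wt_comb R e.+2).
Local Notation vec := 'rV[int]_n.
Implicit Types (x y z : E) (h : vec) (i j p q : 'I_n).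

Definition pt h : E := (n%:R)^-1 *: wtc h.

Lemma pt_hyp h : V (pt h).
Proof. exact/hyp_spaceZ/wt_comb_hyp. Qed.

Lemma pt_diff h i j : pt h 0 j - pt h 0 i = n%:R^-1 * (h 0 j - h 0 i)%:~R.
Proof. by rewrite -wt_comb_diff !mxE mulrBr. Qed.

Lemma ptD h (v : vec) : pt (h + n%:Z *: v) = pt h + wtc v.
Proof.
rewrite /pt; have -> : wtc (h + n%:Z *: v) = wtc h + n%:R *: wtc v.
  rewrite wt_combD; congr (_ + _); rewrite scaler_nat.
  have : forall m : nat, wtc (m%:Z *: v) = wtc v *+ m.
    elim=> [|m IH]; last by rewrite intS scalerDl scale1r wt_combD IH mulrS.
    rewrite scale0r mulr0n; apply/rowP => i; rewrite wt_combE !mxE.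
    by rewrite big1 ?mulr0 ?subr0 // => j _; rewrite mxE.
  exact.
by rewrite scalerDr scalerA mulVf ?pnatr_eq0 // scale1r.
Qed.

Lemma pt_addc h (c : int) : pt (h + const_mx c) = pt h.
Proof. by rewrite /pt; congr (_ *: _); apply/wt_comb_eqP; exists c. Qed.

Lemma D_pt h i j : floor_diff (pt h) i j = divz (h 0 j - h 0 i) n%:Z.
Proof.
rewrite /floor_diff pt_diff; apply: floor_def; set m := h 0 j - h 0 i.
have n0 : (0 : R) < n%:R by rewrite ltr0n.
rewrite -[X in X <= _ < _](mulKf (lt0r_neq0 n0)) -[X in _ <= _ < X](mulKf (lt0r_neq0 n0)).
rewrite ler_pM2l ?invr_gt0 // ltr_pM2l ?invr_gt0 //.
rewrite -[n%:R]/((n%:Z)%:~R : R) -!intrM ler_int ltr_int.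
have := divz_eq m n%:Z; have := ltz_pmod m (isT : 0 < n%:Z); have := @modz_ge0 m n%:Z isT.
by move: (m %/ n)%Z (m %% n)%Z => a b; lia.
Qed.

(** If the opposite floors cancelled, the difference of coordinates would be an integer, and two
    entries of h would be congruent modulo n. *)
Lemma gen_nocong h i j : gen h -> i != j -> floor_diff (pt h) i j + floor_diff (pt h) j i = -1.
Proof.
move=> gh ij; have A := D_anti (pt h) i j; have B := D_ge_anti (pt h) i j.
have : floor_diff (pt h) i j + floor_diff (pt h) j i <> 0; last by lia.
move=> /D_int E; case/eqP: ij; apply: gh => /=; apply/eqP; rewrite eq_sym; apply/res_eqP.
exists (floor_diff (pt h) i j); move: E; rewrite pt_diff => /(canRL (mulVKf _)).
rewrite pnatr_eq0 => /(_ isT); rewrite -[n%:R]/((n%:Z)%:~R : R) -intrM => /intr_inj E.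
by rewrite -E addrC subrK.
Qed.

(** Opposite floors sum to -1 at [pt h] and to at least -1 at x, so the inequalities between the
    floors are equalities. *)
Lemma P_pt_maximal h x : gen h -> V x -> closed_cell x (pt h) -> closed_cell (pt h) x.
Proof.
move=> gh Vx [_ H]; split=> // i j; have [->|ij] := eqVneq i j; first by rewrite !D_refl.
have := gen_nocong gh ij; have := H j i; have := H i j.
have := D_ge_anti x i j; lia.
Qed.

Lemma D_pt_const h h' : gen h -> gen h' ->
  (forall i j, floor_diff (pt h) i j = floor_diff (pt h') i j) -> exists c, h' = h + const_mx c.
Proof.
move=> gh gh' H; apply: no_inversion_const => // p q E.
have /eqP/res_eqP [a] : (h 0 q)%:~R = (h 0 p + 1)%:~R :> 'I_n by rewrite intrD E.
have pq : q != p by apply/eqP => F; move/eqP: E; rewrite F eq_sym addr1_neq.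
move=> {}E; have := H p q; rewrite !D_pt E.
have -> : h 0 p + 1 + n%:Z * a - h 0 p = a * n%:Z + 1 by lia.
rewrite divzMDl // (divz_small (m := 1)) // addr0 => Ea.
have ne : h' 0 q - h' 0 p != n%:Z * a.
  apply/eqP => F; case/eqP: pq; apply: gh' => /=.
  by rewrite (_ : h' 0 q = h' 0 p + n%:Z * a) ?intrD ?res_mulr ?addr0 // -F addrC subrK.
have := divz_eq (h' 0 q - h' 0 p) n%:Z; have := @modz_ge0 (h' 0 q - h' 0 p) n%:Z isT.
rewrite -Ea; move: (_ %% _)%Z => b; move: ne; move: (h' 0 q) (h' 0 p) (h 0 p) => u v w.
by move/eqP; lia.
Qed.

Lemma P_pt_eq h h' : gen h -> gen h' ->
  closed_cell (pt h) = closed_cell (pt h') <-> exists c, h' = h + const_mx c.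
Proof.
move=> gh gh'; split=> [/P_eq H|[c ->]]; last by rewrite pt_addc.
by apply: D_pt_const => //; apply: H; exact: pt_hyp.
Qed.

Definition frac_part x i : R := x 0 i - (Num.floor (x 0 i))%:~R.

Lemma alcove_exists x : V x -> exists2 h, gen h & closed_cell (pt h) x.
Proof.
move=> Vx; pose lt i j := (frac_part x i < frac_part x j) || ((frac_part x i == frac_part x j) && (i < j)%N).
have lt_irr i : lt i i = false by rewrite /lt ltxx eqxx ltnn.
have lt_tr i j p : lt i j -> lt j p -> lt i p.
  rewrite /lt => /orP[a|/andP[/eqP a b]] /orP[c|/andP[/eqP c f]].
  - by rewrite (lt_trans a c).
  - by rewrite -c a.
  - by rewrite a c.
  - by rewrite a c eqxx (ltn_trans b f) orbT.
have lt_tot i j : i != j -> lt i j || lt j i.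
  move=> ij; rewrite /lt; case: (ltgtP (frac_part x i) (frac_part x j)) => //= _.
  by rewrite -neq_ltn.
pose rk i := #|[pred j | lt j i]|.
have rk_lt i j : lt i j -> (rk i < rk j)%N.
  move=> ij; apply: proper_card; apply/properP; split.
    by apply/fintype.subsetP => p; rewrite !inE => /lt_tr; apply.
  by exists i; rewrite !inE ?lt_irr.
have rk_n i : (rk i < n)%N.
  rewrite -[X in (_ < X)%N](card_ord n); apply: proper_card; apply/properP.
  by split; [apply/fintype.subsetP => j _ | exists i; rewrite !inE ?lt_irr].
(* The ranks of the fractional parts, with ties broken by the index, supply n distinct residues; any
   way of breaking ties gives an alcove having x in its closure. *)
pose h : vec := \row_i (n%:Z * Num.floor (x 0 i) + (rk i)%:Z).
have gh : gen h.
  move=> i j /=; rewrite !mxE !intrD !res_mulr !add0r -!pmulrn => E.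
  apply/eqP/negPn/negP => /lt_tot; have {}E : rk i = rk j.
    have := congr1 val E; rewrite !Zp_nat /= !modn_small //.
  by case/orP => /rk_lt; rewrite E ltnn.
exists h => //; split=> // i j; rewrite D_pt D_geP.
rewrite !mxE; have Fi : x 0 i = (Num.floor (x 0 i))%:~R + frac_part x i by rewrite /frac_part addrC subrK.
have Fj : x 0 j = (Num.floor (x 0 j))%:~R + frac_part x j by rewrite /frac_part addrC subrK.
rewrite {2}Fi {2}Fj; move: (Num.floor (x 0 i)) (Num.floor (x 0 j)) => a b.
have -> : n%:Z * b + (rk j)%:Z - (n%:Z * a + (rk i)%:Z) =
  (b - a) * n%:Z + ((rk j)%:Z - (rk i)%:Z) by lia.
rewrite divzMDl // intrD intrB.
have fi : 0 <= frac_part x i < 1 by rewrite /frac_part subr_ge0 floor_le ltrBlDl -[1]/(1%:~R) -intrD floorD1_gt.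
have fj : 0 <= frac_part x j < 1 by rewrite /frac_part subr_ge0 floor_le ltrBlDl -[1]/(1%:~R) -intrD floorD1_gt.
case: (leqP (rk i) (rk j)) => [le|gt].
  rewrite divz_small; last by have := rk_n j; lia.
  have : frac_part x i <= frac_part x j.
    rewrite leNgt; apply/negP => fl; have := rk_lt j i; rewrite /lt fl => /(_ isT); lia.
  by rewrite addr0 => H; lra.
have -> : divz ((rk j)%:Z - (rk i)%:Z) n%:Z = -1.
  rewrite (_ : _ - _ = -1 * n%:Z + (n%:Z + (rk j)%:Z - (rk i)%:Z)); last lia.
  by rewrite divzMDl // divz_small ?addr0 //; have := rk_n i; lia.
by rewrite mulrNz; lra.
Qed.

End Alcoves.

Lemma divz_near (N m m' : int) : 0 < N -> ~~ (N %| m)%Z -> ~~ (N %| m')%Z ->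
  `|m - m'| <= 1 -> divz m N = divz m' N.
Proof.
move=> N0 d d'; rewrite ler_norml.
have := divz_eq m N; have := divz_eq m' N.
have := ltz_pmod m N0; have := ltz_pmod m' N0.
have : modz m N != 0 by apply: contra d => /eqP/dvdz_mod0P.
have : 0 <= modz m N by rewrite modz_ge0 ?gt_eqF.
have : modz m' N != 0 by apply: contra d' => /eqP/dvdz_mod0P.
have : 0 <= modz m' N by rewrite modz_ge0 ?gt_eqF.
move: (divz m N) (divz m' N) (modz m N) (modz m' N) => q q' r r'.
move=> r'0 r'n r0 rn *.
have [//|[lt|lt]] : q = q' \/ q + 1 <= q' \/ q' + 1 <= q by lia.
  have : 0 <= (q' - q - 1) * N by apply: mulr_ge0; lia.
  lia.
have : 0 <= (q - q' - 1) * N by apply: mulr_ge0; lia.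
lia.
Qed.

(** * Ridges and the alcoves around them *)

Section Ridges.
Variables (R : realType) (e : nat).
Local Notation n := e.+3.
Local Notation E := 'rV[R]_n.
Local Notation V := (@hyp_space R e.+2).
Local Notation wtc := (@wt_comb R e.+2).
Local Notation pt := (@pt R e).
Local Notation vec := 'rV[int]_n.
Implicit Types (x y z : E) (h : vec) (i j p q : 'I_n).

Definition cong z i j := floor_diff z i j + floor_diff z j i = 0.

Definition only_pair z p q := [/\ p != q, cong z p q &
  forall i j, i != j -> cong z i j -> (i = p /\ j = q) \/ (i = q /\ j = p)].

Lemma vertices_range z : V z -> [set v | closed_cell z v /\ sigma_face [set v]] = range (vtx z).
Proof.
move=> Vz; apply/seteqP; split=> v /=.
  by case=> Pv sv; have [i ->] := vtx_complete Vz Pv sv; exists i.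
case=> i _ <-; split; first exact: vtx_P.
by apply/sigma_vertexP; eexists.
Qed.

(** Dimension e + 1 means n - 1 vertices, listed by [vtx] over n indices: exactly one pair of
    indices gives the same vertex. *)
Lemma ridgeP z : V z -> has_dim (closed_cell z) e.+1 <-> exists p q, only_pair z p q.
Proof.
move=> Vz; rewrite /has_dim vertices_range //; split.
  case/range_card_pred_inv => p [q [pq /vtx_eq cpq H]]; exists p, q; split=> // i j ij cij.
  by apply: H => //; apply/vtx_eq.
case=> p [q [pq cpq H]]; apply: (@range_card_pred _ _ _ p q) => //; first exact/vtx_eq.
by move=> i j ij /vtx_eq; exact: H.
Qed.

Lemma P_noncong z x i j : closed_cell x z -> V z -> ~ cong z i j -> i != j -> floor_diff x i j = floor_diff z i j.
Proof.
case=> _ H Vz nc ij; have := H i j; have := H j i.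
have := D_ge_anti x i j; have := D_anti z i j; rewrite /cong in nc; lia.
Qed.

(** Every other difference changes by at most 1 and is a multiple of n neither before nor after, so
    its quotient by n is unchanged. *)
Lemma D_swap_other h a b i j : gen h -> (h 0 b)%:~R = (h 0 a)%:~R + 1 :> 'I_n ->
  ~ ((i = a /\ j = b) \/ (i = b /\ j = a)) ->
  floor_diff (pt (swap_row (h 0 a)%:~R h)) i j = floor_diff (pt h) i j.
Proof.
move=> gh F; have gS := @gen_S _ (h 0 a)%:~R _ gh.
  move=> nij; have [->|ij] := eqVneq i j; first by rewrite !D_refl.
  have ndiv (g : vec) : gen g -> (g 0 j - g 0 i)%R \notin dvdz n%:Z.
    move=> gg; rewrite -[_ \in _]/(_ %| _)%Z -res_eq0 intrB subr_eq0; apply: contra ij => /eqP /gg ->.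
    by rewrite eqxx.
  rewrite !D_pt; apply: divz_near => //; [exact: ndiv | exact: ndiv |].
  rewrite (S_swapE gh F) !mxE /= ; move: nij.
  case: (eqVneq i a) => [->|ia]; case: (eqVneq i b) => [ib|ib];
    case: (eqVneq j a) => [ja|ja]; case: (eqVneq j b) => [jb|jb] nij;
    rewrite /= ?addr0 ?subr0; try (by case: nij; auto); try (by rewrite ler_norml; lia).
Qed.

Lemma D_swap h a b (t : int) : gen h -> (h 0 b)%:~R = (h 0 a)%:~R + 1 :> 'I_n ->
  h 0 b = h 0 a + 1 + n%:Z * t ->
  floor_diff (pt h) a b = t /\ floor_diff (pt (swap_row (h 0 a)%:~R h)) a b = t - 1.
Proof.
move=> gh F ht.
have ab : b != a by apply/eqP => G; move/eqP: F; rewrite G eq_sym addr1_neq.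
split.
  rewrite D_pt ht (_ : _ - _ = t * n%:Z + 1); last by lia.
  by rewrite divzMDl // (divz_small (m := 1)) // addr0.
rewrite D_pt (S_swapE gh F) !mxE !eqxx /= (negbTE ab) [a == b]eq_sym (negbTE ab) /= ht.
rewrite (_ : _ - _ = (t - 1) * n%:Z + (n%:Z - 1)); last by lia.
by rewrite divzMDl // divz_small ?addr0 //; lia.
Qed.

(* If the alcoves h and h' meet in a ridge, their floors differ only at the pair
   of coordinates congruent on that ridge, so any adjacent inversion is that pair. *)
Lemma ridge_adjacent z h h' : V z -> has_dim (closed_cell z) e.+1 -> gen h -> gen h' ->
  closed_cell (pt h) z -> closed_cell (pt h') z -> (exists c, h' = h + const_mx c) \/
  exists i c, h' = swap_row i h + const_mx c.
Proof.
move=> Vz /(ridgeP Vz) [p [q [pq cpq only]]] gh gh' Pz Pz'.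
have same (i j : 'I_n) : ~ ((i = p /\ j = q) \/ (i = q /\ j = p)) -> floor_diff (pt h) i j = floor_diff (pt h') i j.
  move=> ne; have [->|ij] := eqVneq i j; first by rewrite !D_refl.
  have nc : ~ cong z i j by move=> c; apply: ne; exact: only.
  by rewrite (P_noncong Pz) // (P_noncong Pz').
have [inv|noinv] := pselect (exists a b, (h 0 b)%:~R = (h 0 a)%:~R + 1 :> 'I_n /\
     h' 0 b - h' 0 a <= h 0 b - h 0 a - 1); last first.
  left; apply: no_inversion_const => // a b F.
  by rewrite ltNge; apply/negP => le; apply: noinv; exists a, b.
case: inv => a [b [F le]]; right.
have ab : b != a by apply/eqP => G; move/eqP: F; rewrite G eq_sym addr1_neq.
have /eqP/res_eqP [t] : (h 0 b)%:~R = (h 0 a + 1)%:~R :> 'I_n by rewrite intrD F.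
move=> ht.
have [Dh Dab] := D_swap gh F ht.
have ne : h' 0 b - h' 0 a != n%:Z * t.
  apply/eqP => G; case/eqP: ab; apply: gh' => /=.
  by rewrite (_ : h' 0 b = h' 0 a + n%:Z * t) ?intrD ?res_mulr ?addr0 // -G addrC subrK.
have Dh' : floor_diff (pt h') a b < t.
  rewrite D_pt ltz_divLR //.
  by move: le ne; rewrite ht; move: (h' 0 a) (h' 0 b) (h 0 a) => u v w; lia.
have isab : (a = p /\ b = q) \/ (a = q /\ b = p).
  by apply: contrapT => /same; lia.
have gS := @gen_S _ (h 0 a)%:~R _ gh.
exists (h 0 a)%:~R; apply: (@D_pt_const R) => //.
(* At z the two floors of this pair cancel, and at an alcove point they sum to -1, so each alcove
   lowers exactly one of them by 1; [Dh'] tells which one h' lowers. *)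
have Dab' : floor_diff (pt h') a b = t - 1.
  case: isab => -[Ea Eb]; subst a b.
    have := Pz.2 p q; have := Pz'.2 p q; have := Pz.2 q p; have := Pz'.2 q p.
    have := gen_nocong R gh pq; have := gen_nocong R gh' pq; move: cpq; rewrite /cong.
    lia.
  have := Pz.2 p q; have := Pz'.2 p q; have := Pz.2 q p; have := Pz'.2 q p.
  have := gen_nocong R gh pq; have := gen_nocong R gh' pq; move: cpq; rewrite /cong.
  lia.
have other := D_swap_other gh F.
move=> i j.
have [H|H] := pselect ((i = a /\ j = b) \/ (i = b /\ j = a)).
  have F1 := gen_nocong R gS ab; have F2 := gen_nocong R gh' ab.
  by case: H => -[-> ->]; lia.
rewrite other //; apply: same => G; apply: H.
by case: isab G => -[-> ->] [[-> ->]|[-> ->]]; auto.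
Qed.

(* The common ridge is centred at the midpoint of the two alcove points. *)
Lemma adjacent_ridge h i : gen h ->
  exists z, [/\ V z, has_dim (closed_cell z) e.+1, closed_cell (pt h) z & closed_cell (pt (swap_row i h)) z].
Proof.
move=> gh; have [p hp] := gen_surj i gh; have [q hq] := gen_surj (i + 1) gh.
have F : (h 0 q)%:~R = (h 0 p)%:~R + 1 :> 'I_n by rewrite hp hq.
have pq : p != q by apply/eqP => G; move/eqP: F; rewrite G eq_sym addr1_neq.
have gS := @gen_S _ i _ gh.
pose z : E := 2%:R^-1 *: (pt h + pt (swap_row i h)).
have Vz : V z by apply/hyp_spaceZ/hyp_spaceD; exact: pt_hyp.
have zd j l : z 0 l - z 0 j =
    2%:R^-1 * ((pt h 0 l - pt h 0 j) + (pt (swap_row i h) 0 l - pt (swap_row i h) 0 j)).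
  have zE i' : z 0 i' = 2%:R^-1 * (pt h 0 i' + pt (swap_row i h) 0 i') by rewrite !mxE.
  by rewrite !zE -mulrBr opprD addrACA.
have /eqP/res_eqP [t ht] : (h 0 q)%:~R = (h 0 p + 1)%:~R :> 'I_n by rewrite intrD F.
have [D1 D2] := D_swap gh F ht; rewrite hp in D2.
have pqN := gen_nocong R gh pq; have pqS := gen_nocong R gS pq.
have zpq : z 0 q - z 0 p = t%:~R.
  rewrite zd !pt_diff -hp (S_swapE gh F) !mxE !eqxx /= (negbTE pq) eq_sym (negbTE pq) /= ht.
  rewrite -mulrDr -intrD (_ : _ + _ = n%:Z * t * 2); last by lia.
  have nE : (n%:Z)%:~R = n%:R :> R by [].
  have tE : (2 : int)%:~R = 2%:R :> R by [].
  by rewrite !intrM nE tE -mulrA mulKf ?pnatr_eq0 // mulrC mulfK ?pnatr_eq0.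
have Dz1 : floor_diff z p q = t by rewrite /floor_diff zpq intrKfloor.
have Dz2 : floor_diff z q p = - t by rewrite /floor_diff -opprB zpq -mulrNz intrKfloor.
have bounds j l (w : E) m : floor_diff w j l = m -> floor_diff w j l + floor_diff w l j = -1 ->
    m%:~R < w 0 l - w 0 j < m%:~R + 1.
  move=> Dm Dn; have := floorD1_gt (w 0 l - w 0 j); have := floorD1_gt (w 0 j - w 0 l).
  rewrite -/(floor_diff w j l) -/(floor_diff w l j) (_ : floor_diff w l j = -1 - m); last by lia.
  by rewrite Dm (_ : -1 - m + 1 = - m) ?mulrNz ?intrD; [lra | lia].
have zother j l : j != l -> ~ ((j = p /\ l = q) \/ (j = q /\ l = p)) ->
    (floor_diff (pt h) j l)%:~R < z 0 l - z 0 j < (floor_diff (pt h) j l)%:~R + 1.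
  move=> jl npq; have := D_swap_other gh F npq; rewrite hp => Sd.
  have := bounds j l (pt h) _ erefl (gen_nocong R gh jl).
  by have := bounds j l (pt (swap_row i h)) _ Sd (gen_nocong R gS jl); rewrite zd; lra.
have zge j l : floor_diff (pt h) j l <= floor_diff z j l /\ floor_diff (pt (swap_row i h)) j l <= floor_diff z j l.
  have [->|jl] := eqVneq j l; first by rewrite !D_refl.
  have [npq|npq] := pselect ((j = p /\ l = q) \/ (j = q /\ l = p)).
    by case: npq => -[-> ->]; lia.
  have := D_swap_other gh F npq; rewrite hp => ->.
  by rewrite D_geP; have := zother j l jl npq; move=> /andP[/ltW].
exists z; split=> //; last 2 first.
- by split=> // j l; case: (zge j l).
- by split=> // j l; case: (zge j l).
apply/(ridgeP Vz); exists p, q; split=> // [|j l jl cjl]; first by rewrite /cong; lia.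
apply: contrapT => npq; have := zother j l jl npq.
rewrite (D_int cjl) -[1]/(1%:~R) -intrD !ltr_int; lia.
Qed.

End Ridges.

(** * Classes of facets *)

Section Classes.
Variables (R : realType) (e k : nat).
Local Notation n := e.+3.
Local Notation E := 'rV[R]_n.
Local Notation V := (@hyp_space R e.+2).
Local Notation wtc := (@wt_comb R e.+2).
Local Notation pt := (@pt R e).
Local Notation vec := 'rV[int]_n.
Local Notation kk := (fun _ : 'I_n => k).
Local Notation Lat := (@Lk R e.+2 kk).
Local Notation cls := (@translate_class R e.+2 kk).
Local Notation TF := (@Tface R e.+2 kk).
Local Notation GV := (@Gvertex R e.+2 kk).
Implicit Types (x y z v w : E) (h : vec) (i j : 'I_n).

Lemma LkP v : Lat v <-> exists2 l, inL k l & v = wtc l.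
Proof.
by split=> [[b _ <-]|[l [b ->] ->]]; [exists (b *m Mmat kk) => //; exists b | exists b].
Qed.

Lemma Lk0 : Lat 0.
Proof.
apply/LkP; exists 0; first exact: inL0.
by apply/rowP => i; rewrite wt_combE !mxE big1 ?mulr0 ?subr0 // => j _; rewrite mxE.
Qed.

Lemma LkD v w : Lat v -> Lat w -> Lat (v + w).
Proof.
move=> /LkP[l Ll ->] /LkP[l' Ll' ->]; apply/LkP.
by exists (l + l'); [exact: inLD | rewrite wt_combD].
Qed.

Lemma LkN v : Lat v -> Lat (- v).
Proof.
by move=> /LkP[l Ll ->]; apply/LkP; exists (- l); [exact: inLN | rewrite wt_combN].
Qed.

Definition translate (F : set E) v : set E := [set x + v | x in F].

Lemma translateD (F : set E) v w : translate (translate F v) w = translate F (v + w).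
Proof.
apply/seteqP; split=> y.
  by case=> _ [x Fx <-] <-; exists x; rewrite ?addrA.
by case=> x Fx <-; exists (x + v); rewrite ?addrA //; exists x.
Qed.

Lemma translate0 (F : set E) : translate F 0 = F.
Proof.
apply/seteqP; split=> y; first by case=> x Fx <-; rewrite addr0.
by move=> Fy; exists y; rewrite ?addr0.
Qed.

Lemma P_translate x (a : vec) : translate (closed_cell x) (wtc a) = closed_cell (x + wtc a).
Proof.
apply/seteqP; split=> y.
  case=> u [Vu H] <-; split=> [|i j]; first exact/hyp_spaceD/wt_comb_hyp.
  by rewrite !D_addl; have := H i j; lia.
case=> Vy H; exists (y + wtc (- a)); last first.
  by rewrite wt_combN subrK.
split=> [|i j]; first exact/hyp_spaceD/wt_comb_hyp.
have := H i j; rewrite !D_addl !mxE.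
by move: (floor_diff x i j) (floor_diff y i j) (a 0 i) (a 0 j) => b c u v; lia.
Qed.

Lemma cls_translate (F : set E) v : Lat v -> cls (translate F v) = cls F.
Proof.
move=> Lv; apply/seteqP; split=> G [w Lw <-].
  exists (v + w); first exact: LkD.
  by rewrite -/(translate _ _) -translateD.
exists (w - v); first exact/LkD/LkN.
by rewrite -/(translate _ _) -/(translate F w) translateD [v + _]addrC subrK.
Qed.

Lemma mem_cls (F : set E) : cls F F.
Proof. by exists 0; [exact: Lk0 | exact: translate0]. Qed.

Lemma clsP (F G : set E) : cls F G <-> cls F = cls G.
Proof.
split=> [[v Lv <-]|->]; last exact: mem_cls.
by rewrite -/(translate _ _) cls_translate.
Qed.

Lemma Tface_P (c : TF) : exists2 x, V x & val c = cls (closed_cell x).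
Proof.
case: c => X /= /set_mem [F /sigma_faceP [x Vx ->] <-].
by exists x.
Qed.

Lemma Tface_mem (c : TF) (F : set E) : val c F -> val c = cls F.
Proof. by have [x Vx ->] := Tface_P c; move/clsP. Qed.

Lemma Tface_mk x : V x -> exists c : TF, val c = cls (closed_cell x).
Proof.
move=> Vx; have H : (translate_class kk @` @sigma_face R e.+2) (cls (closed_cell x)).
  by exists (closed_cell x) => //; apply/sigma_faceP; exists x.
by exists (exist (fun X => X \in _) _ (mem_set H)).
Qed.

Lemma Tincl_P (c c' : TF) : Tincl c c' <->
  exists x x', [/\ V x, V x', val c = cls (closed_cell x), val c' = cls (closed_cell x') & closed_cell x' x].
Proof.
split=> [[F [F' [cF cF' sub]]]|[x [x' [Vx Vx' Ec Ec' H]]]]; last first.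
  exists (closed_cell x), (closed_cell x'); rewrite Ec Ec'; split; [exact: mem_cls|exact: mem_cls|].
  exact/P_subset.
have face (d : TF) G : val d G -> exists2 x, V x & G = closed_cell x.
  have [x Vx ->] := Tface_P d; move=> [v /LkP [l _ ->] <-].
  exists (x + wtc l); last by rewrite -P_translate.
  exact/hyp_spaceD/wt_comb_hyp.
have [x Vx EF] := face _ _ cF; have [x' Vx' EF'] := face _ _ cF'; subst F F'.
by exists x, x'; split=> //; [exact: Tface_mem | exact: Tface_mem | apply/P_subset].
Qed.

Lemma val_TF_inj : injective (val : TF -> set (set E)).
Proof. exact: val_inj. Qed.

Definition rep (u : GV) h := gen h /\ val (val u) = cls (closed_cell (pt h)).

Lemma rep_exists (u : GV) : exists h, rep u h.
Proof.
have umax := set_mem (valP u); have [x Vx Ex] := Tface_P (val u).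
have [h gh Px] := alcove_exists Vx; exists h; split=> //.
have [c Ec] := Tface_mk (pt_hyp R h).
have <- : c = val u by apply: umax; apply/Tincl_P; exists x, (pt h); split=> //; exact: pt_hyp.
exact: Ec.
Qed.

Lemma rep_mk h : gen h -> exists u, rep u h.
Proof.
move=> gh; have [c Ec] := Tface_mk (pt_hyp R h).
have cmax : Tfacets c.
  move=> c' /Tincl_P [x [x' [Vx Vx' Ec1 Ec' H]]]; apply: val_TF_inj; rewrite Ec1 Ec'.
  have : cls (closed_cell (pt h)) (closed_cell x) by apply/clsP; rewrite -Ec.
  case=> v /LkP [l Ll ->]; rewrite -/(translate _ _) P_translate -ptD => EP.
  have gh' := @gen_addZ _ _ l gh.
  have H' : closed_cell x' (pt (h + n%:Z *: l)).
    apply/P_subset; first exact: pt_hyp.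
    by rewrite EP; apply/P_subset.
  have H2 := P_pt_maximal gh' Vx' H'.
  congr cls; apply/seteqP; split; apply/P_subset => //.
  by rewrite -EP in H2 *.
by exists (exist (fun d => d \in _) c (mem_set cmax)).
Qed.

Lemma rep_eq u u' h h' : rep u h -> rep u' h' -> (u = u' <-> eqv k h h').
Proof.
case=> gh Eu [gh' Eu']; split=> [E|[c [l Ll El]]]; last first.
  apply/val_inj/val_TF_inj; rewrite Eu Eu'; apply/clsP.
  exists (wtc l); first by apply/LkP; exists l.
  rewrite -/(translate _ _) P_translate -ptD El addrAC.
  by rewrite pt_addc.
have : cls (closed_cell (pt h)) (closed_cell (pt h')) by apply/clsP; rewrite -Eu -Eu' E.
case=> v /LkP [l Ll ->]; rewrite -/(translate _ _) P_translate -ptD.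
move/P_pt_eq => -/(_ (@gen_addZ _ _ l gh) gh') [c ->].
by exists c, l => //; rewrite addrAC.
Qed.

(** [Tincl] compares some pair of representatives; translating both makes the lower face the
    prescribed one. *)
Lemma facet_above (r : TF) (u : GV) h z : rep u h -> V z -> val r = cls (closed_cell z) ->
  Tincl r (val u) -> exists2 l, inL k l & closed_cell (pt (h + n%:Z *: l)) z.
Proof.
case=> gh Eu Vz Er /Tincl_P [x [x' [Vx Vx' Ex Ex' H]]].
have : cls (closed_cell x) (closed_cell z) by apply/clsP; rewrite -Er -Ex.
case=> v /LkP [l1 L1 ->]; rewrite -/(translate _ _) P_translate => Ez.
have : cls (closed_cell (pt h)) (closed_cell x') by apply/clsP; rewrite -Eu -Ex'.
case=> w /LkP [l2 L2 ->]; rewrite -/(translate _ _) P_translate => Ex2.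
exists (l2 + l1); first exact: inLD.
rewrite ptD wt_combD addrA -P_translate Ex2.
have zx : closed_cell (x + wtc l1) z by rewrite Ez; exact: P_refl.
by move: zx; rewrite -P_translate => -[y xy <-]; exists y => //; exact: P_trans H xy.
Qed.

Hypothesis large : ((0 < k) && ((0 < e) || (1 < k)))%N.

Lemma rep_adj u u' h h' : rep u h -> rep u' h' ->
  (Gadj u u' <-> exists i, eqv k h' (swap_row i h)).
Proof.
move=> ru ru'; have [gh Eu] := ru; have [gh' Eu'] := ru'; split.
  case=> uu' [r [F rF dF] [ru1 ru2]].
  have [x Vx Er] := Tface_P r; move: (rF); rewrite Er => -[v /LkP [l Ll ->]].
  rewrite -/(translate _ _) P_translate => EF; subst F.
  have Vz : V (x + wtc l) by exact/hyp_spaceD/wt_comb_hyp.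
  have Ez := Tface_mem rF.
  have [l1 L1 H1] := facet_above ru Vz Ez ru1.
  have [l2 L2 H2] := facet_above ru' Vz Ez ru2.
  have [[c Ec]|[i [c Ec]]] := ridge_adjacent Vz dF (@gen_addZ _ _ l1 gh) (@gen_addZ _ _ l2 gh') H1 H2.
    case: uu'; apply/(rep_eq ru ru'); apply: eqv_trans (eqv_addL h L1) _.
    by apply: eqv_trans (eqv_sym (eqv_addL h' L2)); rewrite Ec; exact: eqv_addc.
  exists i; apply: eqv_trans (eqv_addL h' L2) _; rewrite Ec.
  apply: eqv_trans (eqv_sym (eqv_addc _ _ _)) _.
  have -> : swap_row i (h + n%:Z *: l1) = swap_row i h + n%:Z *: l1.
    by apply/rowP => j; rewrite !mxE s_mod.
  exact/eqv_sym/eqv_addL.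
case=> i E; have gS := @gen_S _ i _ gh; split.
  (* Were the two vertices equal, a walk of length one would close up and lift, yet the swap moves
     the entry of residue i. *)
  move/(rep_eq ru ru') => E2; have := eqv_trans E2 E.
  move/(short_walk_lift large (w := [:: i])) => -/(_ isT gh) /= F.
  have [p hp] := gen_surj i gh; have := congr1 (fun g : vec => g 0 p) F.
  by rewrite mxE s_up //; lia.
have [z [Vz dz H1 H2]] := adjacent_ridge R i gh.
have [r Er] := Tface_mk Vz; exists r; first by exists (closed_cell z) => //; rewrite Er; exact: mem_cls.
have Eu2 : val (val u') = cls (closed_cell (pt (swap_row i h))).
  have [u2 ru2] := rep_mk gS.
  by have -> : u' = u2 by [apply/(rep_eq ru' ru2)]; case: ru2.
by split; apply/Tincl_P; [exists z, (pt h) | exists z, (pt (swap_row i h))]; split=> //; exact: pt_hyp.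
Qed.

End Classes.

(** * Automorphisms induced by affine maps *)

Section Induced.
Variables (R : realType) (e k : nat).
Local Notation n := e.+3.
Local Notation E := 'rV[R]_n.
Local Notation V := (@hyp_space R e.+2).
Local Notation wtc := (@wt_comb R e.+2).
Local Notation pt := (@pt R e).
Local Notation shft := (@Defs.shift R e.+2).
Local Notation vec := 'rV[int]_n.
Local Notation kk := (fun _ : 'I_n => k).
Local Notation Lat := (@Lk R e.+2 kk).
Local Notation cls := (@translate_class R e.+2 kk).
Local Notation TF := (@Tface R e.+2 kk).
Local Notation GV := (@Gvertex R e.+2 kk).
Implicit Types (x y z v w : E) (h : vec) (i j : 'I_n).

(** What a map must satisfy to descend to classes of faces. It is always assumed for a map and its
    inverse together, so that images of faces are whole faces and classes go onto classes. *)
Record lattice_map (phi psi : E -> E) : Prop := LatticeMap {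
  lm_can : cancel phi psi;
  lm_hyp : forall x, V x -> V (phi x);
  lm_floor : forall x y, V x -> V y -> (closed_cell x y <-> closed_cell (phi x) (phi y));
  lm_trans : forall v, Lat v -> exists2 v', Lat v' & forall x, phi (x + v) = phi x + v'
}.

Lemma image_P phi psi x : lattice_map phi psi -> lattice_map psi phi -> V x ->
  phi @` closed_cell x = closed_cell (phi x).
Proof.
move=> Hf Hg Vx; apply/seteqP; split=> y.
  case=> u Pu <-; apply/(lm_floor Hf Vx) => //; exact: P_hyp Pu.
move=> Py; have Vy := P_hyp Py; exists (psi y); last exact: (lm_can Hg).
by have := (lm_floor Hg (lm_hyp Hf Vx) Vy).1 Py; rewrite (lm_can Hf).
Qed.

Lemma image_cls phi psi x : lattice_map phi psi -> lattice_map psi phi -> V x ->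
  [set phi @` F | F in cls (closed_cell x)] = cls (closed_cell (phi x)).
Proof.
move=> Hf Hg Vx; apply/seteqP; split=> G.
  case=> _ [v Lv <-] <-; have [v' Lv' E] := lm_trans Hf Lv.
  exists v' => //; rewrite -(image_P Hf Hg Vx); apply/seteqP; split=> y.
    by case=> _ [u Pu <-] <-; exists (u + v); [exists u | rewrite E].
  by case=> _ [u Pu <-] <-; exists (phi u); [exists u | rewrite E].
case=> w Lw <-; have [w' Lw' E] := lm_trans Hg Lw.
have E' y : phi (y + w') = phi y + w by rewrite -[y in LHS](lm_can Hf) -E (lm_can Hg).
exists (translate (closed_cell x) w'); first by exists w'.
rewrite -(image_P Hf Hg Vx); apply/seteqP; split=> y.
  by case=> _ [u Pu <-] <-; exists (phi u); [exists u | rewrite E'].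
by case=> _ [u Pu <-] <-; exists (u + w'); [exists u | rewrite E'].
Qed.

Lemma face_map phi psi : lattice_map phi psi -> lattice_map psi phi ->
  exists g : TF -> TF, induced_by phi g.
Proof.
move=> Hf Hg; have loc (c : TF) : exists c' : TF, val c' = [set phi @` F | F in val c].
  have [x Vx ->] := Tface_P c; have [c' Ec'] := Tface_mk k (lm_hyp Hf Vx).
  by exists c'; rewrite (image_cls Hf Hg).
by have [g gP] := choice loc; exists g.
Qed.

Lemma face_map_can phi psi (g g' : TF -> TF) : cancel phi psi ->
  induced_by phi g -> induced_by psi g' -> cancel g g'.
Proof.
move=> K Eg Eg' c; apply: val_TF_inj; rewrite Eg' Eg.
have I (F : set E) : psi @` (phi @` F) = F.
  by rewrite image_comp; apply/seteqP; split=> y; [case=> u Fu <- | move=> Fy; exists y] => //=; rewrite K.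
apply/seteqP; split=> F; first by case=> _ [F' cF' <-] <-; rewrite I.
by move=> cF; exists (phi @` F); [exists F | rewrite I].
Qed.

Lemma face_map_incl phi (g : TF -> TF) c c' : induced_by phi g ->
  Tincl c c' -> Tincl (g c) (g c').
Proof.
move=> Eg [F [F' [cF cF' sub]]]; exists (phi @` F), (phi @` F').
by rewrite !Eg; split; [exists F | exists F' | exact: image_subset].
Qed.

Lemma lattice_map_induces phi psi : lattice_map phi psi -> lattice_map psi phi ->
  exists g (f : GV -> GV), [/\ induced_by phi g, AutT g,
    forall u, val (f u) = g (val u) & bijective f].
Proof.
move=> Hf Hg; have [g Eg] := face_map Hf Hg; have [g' Eg'] := face_map Hg Hf.
have K := face_map_can (lm_can Hf) Eg Eg'; have K' := face_map_can (lm_can Hg) Eg' Eg.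
have facet (a b : TF -> TF) p p' : induced_by p a -> induced_by p' b -> cancel a b ->
    cancel b a -> forall u : GV, exists u' : GV, val u' = a (val u).
  move=> Ea Eb ab ba u; have umax := set_mem (valP u).
  have amax : Tfacets (a (val u)).
    move=> c' /(face_map_incl Eb); rewrite ab => /umax E; by rewrite -E ba.
  by exists (exist (fun d => d \in _) _ (mem_set amax)).
have [f fE] := choice (facet _ _ _ _ Eg Eg' K K').
have [f' fE'] := choice (facet _ _ _ _ Eg' Eg K' K).
exists g, f; split=> //.
  split; first by exists g'.
  move=> c c'; split; last exact: face_map_incl.
  by move/(face_map_incl Eg'); rewrite !K.
by exists f' => u; apply: val_inj; [rewrite fE' fE K | rewrite fE fE' K'].
Qed.

Lemma rep_image phi psi g (f : GV -> GV) (u : GV) h h' :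
  lattice_map phi psi -> lattice_map psi phi -> induced_by phi g ->
  (forall u, val (f u) = g (val u)) -> gen h' -> phi (pt h) = pt h' ->
  rep u h -> rep (f u) h'.
Proof.
move=> Hf Hg Eg Ef gh' E [gh Eu]; split=> //.
by rewrite Ef Eg Eu (image_cls Hf Hg) ?E //; exact: pt_hyp.
Qed.

Lemma D_opp x i j : floor_diff (- x) i j = floor_diff x j i.
Proof. by rewrite /floor_diff !mxE opprK addrC. Qed.

Lemma lattice_map_opp : lattice_map (fun x => - x) (fun x => - x).
Proof.
have hypN x : V x -> V (- x).
  by rewrite -scaleN1r; exact: hyp_spaceZ.
split=> [x|x||v Lv]; [exact: opprK | exact: hypN | | ]; last first.
  by exists (- v); [exact: LkN | move=> x; rewrite opprD].
move=> x y Vx Vy; split=> -[_ H]; split; try exact: hypN; try by [].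
  by move=> i j; rewrite !D_opp.
by move=> i j; have := H j i; rewrite !D_opp.
Qed.

Lemma lattice_map_translation (a : vec) :
  lattice_map (fun x => x + wtc a) (fun x => x + wtc (- a)).
Proof.
have hypT x b : V x -> V (x + wtc b) by move=> Vx; exact/hyp_spaceD/wt_comb_hyp.
split=> [x|x||v Lv]; [by rewrite wt_combN addrK | exact: hypT | |]; last first.
  by exists v => // x; rewrite addrAC.
move=> x y Vx Vy; split=> -[_ H]; split; try exact: hypT; try by [].
  by move=> i j; rewrite !D_addl lerD2r.
by move=> i j; have := H i j; rewrite !D_addl lerD2r.
Qed.

Definition unshift x : E := \row_j x 0 (j + 1).

Lemma shiftE x j : shft x 0 j = x 0 (j - 1).
Proof. by rewrite mxE ord_predE. Qed.

Lemma shift_wt_comb (a : vec) : shft (wtc a) = wtc (\row_j a 0 (j - 1)).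
Proof.
apply/rowP => j; rewrite shiftE !wt_combE mxE; congr (_ - _ * _%:~R).
by rewrite (reindex_inj (addIr (-1))) /=; apply: eq_bigr => i _; rewrite mxE.
Qed.

Lemma unshift_wt_comb (a : vec) : unshift (wtc a) = wtc (\row_j a 0 (j + 1)).
Proof.
apply/rowP => j; rewrite mxE !wt_combE mxE; congr (_ - _ * _%:~R).
by rewrite (reindex_inj (addIr 1)) /=; apply: eq_bigr => i _; rewrite mxE.
Qed.

Lemma inL_rot (c : 'I_n) (l : vec) : inL k l -> inL k (\row_j l 0 (j - c)).
Proof.
case=> b ->; exists (\row_j b 0 (j - c)); apply/rowP => j.
by rewrite mxE !mulME !mxE [j - c - 1]addrAC.
Qed.

Lemma lattice_map_shift :
  lattice_map shft unshift /\ lattice_map unshift shft.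
Proof.
have K1 : cancel shft unshift.
  by move=> x; apply/rowP => j; rewrite mxE shiftE addrK.
have K2 : cancel unshift shft.
  by move=> x; apply/rowP => j; rewrite shiftE mxE subrK.
have V1 x : V x -> V (shft x).
  rewrite /hyp_space /= => Vx; rewrite -[RHS]Vx [in RHS](reindex_inj (addIr (-1))).
  by apply: eq_bigr => j _; rewrite shiftE.
have V2 x : V x -> V (unshift x).
  rewrite /hyp_space /= => Vx; rewrite -[RHS]Vx [in RHS](reindex_inj (addIr 1)).
  by apply: eq_bigr => j _; rewrite mxE.
have D1 x i j : floor_diff (shft x) i j = floor_diff x (i - 1) (j - 1) by rewrite /floor_diff !shiftE.
have D2 x i j : floor_diff (unshift x) i j = floor_diff x (i + 1) (j + 1) by rewrite /floor_diff !mxE.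
split; split=> //.
- move=> x y Vx Vy; split=> -[_ H]; split=> //; try exact: V1.
    by move=> i j; rewrite !D1.
  by move=> i j; have := H (i + 1) (j + 1); rewrite !D1 !addrK.
- move=> v /LkP [l Ll ->]; exists (shft (wtc l)).
    by rewrite shift_wt_comb; apply/LkP; exists (\row_j l 0 (j - 1)) => //; exact: inL_rot.
  by move=> x; apply/rowP => j; rewrite !mxE.
- move=> x y Vx Vy; split=> -[_ H]; split=> //; try exact: V2.
    by move=> i j; rewrite !D2.
  by move=> i j; have := H (i - 1) (j - 1); rewrite !D2 !subrK.
- move=> v /LkP [l Ll ->]; exists (unshift (wtc l)).
    rewrite unshift_wt_comb; apply/LkP; exists (\row_j l 0 (j + 1)) => //.
    by have := inL_rot (-1) Ll; congr (inL _ _); apply/rowP => j; rewrite !mxE opprK.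
  by move=> x; apply/rowP => j; rewrite !mxE.
Qed.

Lemma opp_pt h : - pt h = pt (- h).
Proof. by rewrite /pt wt_combN scalerN. Qed.

Lemma shift_pt h : shft (pt h) = pt (\row_j h 0 (j - 1)).
Proof. by rewrite /pt -shift_wt_comb; apply/rowP => j; rewrite shiftE !mxE ord_predE. Qed.

End Induced.

(** * Generation and counting *)

Section Generation.
Variable X : Type.
Implicit Types (adj : X -> X -> Prop) (A : set (X -> X)) (f g : X -> X).

Lemma generated_base A f : A f -> generated A f.
Proof. by move=> Af H [_ sub]; exact: sub. Qed.

Lemma generated_id A : generated A id.
Proof. by move=> H [[]]. Qed.

Lemma generated_comp A f g : generated A f -> generated A g -> generated A (f \o g).
Proof.
by move=> Gf Gg H HA; case: (HA) => -[_ c _] _; apply: c; [exact: Gf | exact: Gg].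
Qed.

Lemma automorphisms_subgroup adj : is_subgroup (automorphisms adj).
Proof.
split.
- by split; [exists id | ].
- move=> f g [bf ef] [bg eg]; split; first exact: bij_comp.
  by move=> x y /=; rewrite ef eg.
- move=> f g [bf ef] fg gf; split; first by exists f.
  by move=> x y; rewrite -{2}(gf x) -{2}(gf y) ef.
Qed.

Lemma generated_sub_aut adj A :
  A `<=` automorphisms adj -> generated A `<=` automorphisms adj.
Proof. by move=> sub f; apply; split=> //; exact: automorphisms_subgroup. Qed.

End Generation.

(** * Uniqueness of the parameters of a model map *)

Section Counting.
Variables (e k : nat).
Local Notation n := e.+3.
Local Notation vec := 'rV[int]_n.
Hypothesis large : ((0 < k) && ((0 < e) || (1 < k)))%N.
Implicit Types (b : bool) (c i : 'I_n) (h v : vec).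

Definition model_map b c v h : vec := signed_map b (fun j => j - c) v h.

Definition relabel b i : 'I_n := if b then - i - 1 else i.

Lemma Y_S b c v h i : model_map b c v (swap_row i h) = swap_row (relabel b i) (model_map b c v h).
Proof.
rewrite /model_map /signed_map; have -> : \row_j swap_row i h 0 (j - c) + n%:Z *: v =
    swap_row i (\row_j h 0 (j - c) + n%:Z *: v).
  by apply/rowP => j; rewrite !mxE s_mod.
case: b; rewrite ?expr1 ?expr0 ?scale1r //= !scaleN1r.
by apply/rowP => j; rewrite !mxE s_opp opprD !opprK addrK.
Qed.

Lemma gen_Y b c v h : gen h -> gen (model_map b c v h).
Proof. by apply: gen_ymap => i j /addIr. Qed.

Lemma Y_inj b b' c c' v v' :
  (forall h, gen h -> eqv k (model_map b c v h) (model_map b' c' v' h)) ->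
  [/\ b = b', c = c' & inL k (v' - v)].
Proof.
move=> H; have gb := @gen_base e; set h := base e in gb.
have gY := @gen_Y b c v _ gb.
have [m [l Ll E]] := H h gb.
(* The two maps also agree on the neighbour across wall i, and [S_inj] makes labels comparable once
   the constant m is accounted for. *)
have lab i : relabel b i = relabel b' i - m%:~R.
  apply: (S_inj large gY); rewrite -Y_S; apply: eqv_trans (H _ (@gen_S _ i _ gb)) _.
  rewrite Y_S E.
  have -> : swap_row (relabel b' i) (model_map b c v h + const_mx m + n%:Z *: l) =
      swap_row (relabel b' i - m%:~R) (model_map b c v h) + const_mx m + n%:Z *: l.
    by apply/rowP => j; rewrite !mxE s_mod s_shift.
  by apply: eqv_sym; exists m, l.
(* Opposite signs would give 2 = 0 modulo n, on comparing the labels 0 and 1. *)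
have bb : b = b'.
  have := lab 0; have := lab 1; rewrite /relabel; case: b {H gY E lab}; case: b' => //.
    rewrite oppr0 !sub0r => E1 /oppr_inj E0; move: E1.
    by rewrite -E0 subrr -opprD => /eqP; rewrite oppr_eq0 (negbTE (two_neq0 e)).
  rewrite oppr0 !sub0r => /eqP + E0.
  by rewrite -[_ - 1 - _]addrA -E0 addr0 (negbTE (one_neqN1 e)).
subst b'.
have m0 : m%:~R = 0 :> 'I_n.
  by have := lab 0 => /eqP; rewrite -subr_eq0 opprB addrCA subrr addr0 => /eqP.
have cc : c = c'.
  have R (d : 'I_n) w j : ((model_map b d w h) 0 j)%:~R = (-1) ^+ b * (h 0 (j - d))%:~R :> 'I_n.
    by rewrite !mxE intrM rmorphXn rmorphN1 intrD res_mulr addr0.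
  have : (h 0 (0 - c))%:~R = (h 0 (0 - c'))%:~R :> 'I_n.
    have := R c' v' 0; rewrite E !mxE !intrD m0 res_mulr !addr0.
    have := R c v 0; rewrite !mxE => -> /(congr1 (fun x => (-1) ^+ b * x)).
    by rewrite !mulrA -!exprD addnn -mul2n exprM sqrrN expr1n expr1n !mul1r.
  by move/gb => /addrI /oppr_inj.
subst c'; split=> //.
have /eqP := m0; rewrite res_eq0 => /dvdzP [m' Em].
have -> : v' - v = (-1) ^+ b *: (const_mx m' + l).
  apply/rowP => j; have := congr1 (fun u : vec => u 0 j) E; rewrite !mxE Em.
  move: (h 0 (j - c)) (v 0 j) (v' 0 j) (l 0 j) => x y y' z.
  case: b {H gY E lab}; rewrite ?expr1 ?expr0 ?mulN1r ?mul1r => F.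
    have : n%:Z * (y' - y + (m' + z)) = 0 by lia.
    by move/eqP; rewrite mulf_eq0 /= => /eqP; lia.
  have : n%:Z * (y' - y - (m' + z)) = 0 by lia.
  by move/eqP; rewrite mulf_eq0 /= => /eqP; lia.
by apply/inLZ/inLD => //; exact: inL_const.
Qed.

Lemma Y_eqv b c v v' h : inL k (v' - v) -> eqv k (model_map b c v h) (model_map b c v' h).
Proof.
move=> Lv; have -> : model_map b c v' h = model_map b c v h + n%:Z *: ((-1) ^+ b *: (v' - v)).
  by rewrite /model_map /signed_map scalerA [n%:Z * _]mulrC -scalerA -scalerDr -addrA -scalerDr [v + _]addrC subrK.
by apply: eqv_addL; exact: inLZ.
Qed.

End Counting.

(** * Realization by generators and the final count *)

Section Assembly.
Variables (R : realType) (e k : nat).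
Local Notation n := e.+3.
Local Notation vec := 'rV[int]_n.
Local Notation wtc := (@wt_comb R e.+2).
Local Notation kk := (fun _ : 'I_n => k).
Local Notation TF := (@Tface R e.+2 kk).
Local Notation GV := (@Gvertex R e.+2 kk).
Hypothesis large : ((0 < k) && ((0 < e) || (1 < k)))%N.

Lemma vertex_choice : exists q : vec -> GV, forall h, gen h -> rep (q h) h.
Proof.
have [u0 _] := rep_mk R k (@gen_base e).
have loc h : exists u : GV, gen h -> rep u h.
  have [gh|ngh] := pselect (gen h); last by exists u0.
  by have [u ru] := rep_mk R k gh; exists u.
by have [q qP] := choice loc; exists q.
Qed.

Variable q : vec -> GV.
Hypothesis qP : forall h, gen h -> rep (q h) h.

Lemma q_surj u : exists2 h, gen h & q h = u.
Proof.
have [h ru] := rep_exists u; have gh := ru.1; exists h => //.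
apply/(rep_eq (qP gh) ru); exact: eqv_refl.
Qed.

Lemma q_eq h h' : gen h -> gen h' -> (q h = q h' <-> eqv k h h').
Proof. by move=> gh gh'; apply: rep_eq; exact: qP. Qed.

Lemma q_adj h h' : gen h -> gen h' ->
  (Gadj (q h) (q h') <-> exists i, eqv k h' (swap_row i h)).
Proof. by move=> gh gh'; apply: rep_adj => //; exact: qP. Qed.

Lemma realize phi psi b c v (A : set (TF -> TF)) :
  lattice_map k phi psi -> lattice_map k psi phi ->
  (forall h, phi (pt R h) = pt R (model_map b c v h)) ->
  (forall g, AutT g -> induced_by phi g -> A g) ->
  exists2 f, graph_induced A f & forall h, gen h -> f (q h) = q (model_map b c v h).
Proof.
move=> Hf Hg E HA; have [g [f [Eg Ag Ef bf]]] := lattice_map_induces Hf Hg.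
have fq h : gen h -> f (q h) = q (model_map b c v h).
  move=> gh; have gY := @gen_Y _ b c v _ gh.
  have r1 := rep_image Hf Hg Eg Ef gY (E h) (qP gh).
  apply/(rep_eq r1 (qP gY)); exact: eqv_refl.
have fI := bij_inj bf.
exists f => //; split; last by exists g => //; exact: HA.
split=> // x y; have [h gh <-] := q_surj x; have [h' gh' <-] := q_surj y.
have gY := @gen_Y _ b c v _ gh; have gY' := @gen_Y _ b c v _ gh'.
(* Adjacency is not followed through [phi]: it is read from wall labels, which [model_map] permutes
   by the involution [relabel]. *)
have key i : eqv k h' (swap_row i h) <-> eqv k (model_map b c v h') (swap_row (relabel b i) (model_map b c v h)).
  have gS := @gen_S _ i _ gh; rewrite -Y_S; have gYS := @gen_Y _ b c v _ gS.
  rewrite -(q_eq gh' gS) -(q_eq gY' gYS) -!fq //.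
  by split=> [->|/fI].
rewrite !fq //; split.
  move/(q_adj gY gY') => [i Ei]; apply/(q_adj gh gh'); exists (relabel b i).
  apply/key; rewrite /relabel; case: b {E fq gY gY' key} Ei => //.
  by rewrite opprD !opprK addrK.
by move/(q_adj gh gh') => [i /key Ei]; apply/(q_adj gY gY'); exists (relabel b i).
Qed.

Local Notation gens := (graph_induced (Taut R kk `|` Raut R kk `|` Caut R kk)).

Lemma graph_induced_sub (A B : set (TF -> TF)) (f : GV -> GV) :
  A `<=` B -> graph_induced A f -> graph_induced B f.
Proof. by move=> AB [Af [g Ag E]]; split=> //; exists g => //; exact: AB. Qed.

Lemma generated_realize b c v :
  exists2 f : GV -> GV, generated gens f & forall h, gen h -> f (q h) = q (model_map b c v h).
Proof.
have [fR GR ER] : exists2 f, generated gens f & forall h, gen h -> f (q h) = q (- h).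
  have E (h : vec) : - pt R h = pt R (model_map true 0 0 h).
    rewrite opp_pt; congr pt; apply/rowP => j.
    by rewrite !mxE expr1 mulN1r mulr0 addr0 subr0.
  have [//|f Gf Ef] := @realize _ _ true 0 0 (Raut R kk) (lattice_map_opp R e k) (lattice_map_opp R e k) E.
  have sub : Raut R kk `<=` Taut R kk `|` Raut R kk `|` Caut R kk by move=> g Ag; left; right.
  exists f; first exact: (generated_base (graph_induced_sub sub Gf)).
  move=> h gh; rewrite Ef //; congr q; apply/rowP => j.
  by rewrite !mxE expr1 mulN1r mulr0 addr0 subr0.
have [fT GT ET] : exists2 f, generated gens f & forall h, gen h -> f (q h) = q (h + n%:Z *: v).
  have YE (h : vec) : model_map false 0 v h = h + n%:Z *: v.
    by apply/rowP => j; rewrite !mxE expr0 mul1r subr0.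
  have E (h : vec) : pt R h + wtc v = pt R (model_map false 0 v h) by rewrite YE ptD.
  have L2 := lattice_map_translation R k (- v); rewrite opprK in L2.
  have [g Ag Eg|f Gf Ef] := @realize _ _ false 0 v (Taut R kk) (lattice_map_translation R k v) L2 E.
    by split=> //; exists (wtc v) => //; exists v.
  have sub : Taut R kk `<=` Taut R kk `|` Raut R kk `|` Caut R kk by move=> g Ag; left; left.
  exists f; first exact: (generated_base (graph_induced_sub sub Gf)).
  by move=> h gh; rewrite Ef // YE.
have [fC GC EC] : exists2 f, generated gens f &
    forall h, gen h -> f (q h) = q (\row_j h 0 (j - 1)).
  have YE (h : vec) : model_map false 1 0 h = \row_j h 0 (j - 1).
    by apply/rowP => j; rewrite !mxE expr0 mul1r mulr0 addr0.
  have E (h : vec) : Defs.shift (pt R h) = pt R (model_map false 1 0 h) by rewrite YE shift_pt.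
  have [L1 L2] := lattice_map_shift R e k.
  have [g Ag Eg|f Gf Ef] := @realize _ _ false 1 0 (Caut R kk) L1 L2 E.
    by split=> //; exists 1%N.
  have sub : Caut R kk `<=` Taut R kk `|` Raut R kk `|` Caut R kk by move=> g Ag; right.
  exists f; first exact: (generated_base (graph_induced_sub sub Gf)).
  by move=> h gh; rewrite Ef // YE.
have rot_gen (d : 'I_n) h : gen h -> gen (\row_j h 0 (j - d)).
  by move=> gh; apply: gen_perm => // i j /addIr.
have [fD GD ED] : exists2 f, generated gens f &
    forall h, gen h -> f (q h) = q (\row_j h 0 (j - c)).
  elim/ord_cyc_ind: c => [|c [f Gf Ef]].
    exists id; first exact: generated_id.
    by move=> h _; congr q; apply/rowP => j; rewrite mxE subr0.
  exists (fC \o f); first exact: generated_comp.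
  move=> h gh /=; rewrite Ef // EC; last exact: rot_gen.
  by congr q; apply/rowP => j; rewrite !mxE opprD addrA addrAC.
have gT h : gen h -> gen (\row_j h 0 (j - c) + n%:Z *: v) by move=> gh; apply/gen_addZ/rot_gen.
case: b.
  exists (fR \o (fT \o fD)); first by do 2![apply: generated_comp => //].
  move=> h gh /=; rewrite ED // ET; last exact: rot_gen.
  by rewrite ER; [rewrite /model_map /signed_map expr1 scaleN1r | exact: gT].
exists (fT \o fD); first exact: generated_comp.
move=> h gh /=; rewrite ED // ET; last exact: rot_gen.
by rewrite /model_map /signed_map expr0 scale1r.
Qed.

Lemma generated_gens : generated gens = AutG R kk.
Proof.
apply/seteqP; split; first by apply: generated_sub_aut => f [].
move=> f Af; have [b [c [v fE]]] := aut_form large q_surj q_eq q_adj Af.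
have [f' Gf' fE'] := generated_realize b c v.
suff -> : f = f' by [].
by apply/funext => u; have [h gh <-] := q_surj u; rewrite fE // fE'.
Qed.

Lemma card_AutG : AutG R kk #= `I_(2 * n * lattice_index e k).
Proof.
have k0 : (0 < k)%N by case/andP: large.
pose T := (bool * 'I_n * 'I_(lattice_index e k))%type.
pose vT (t : T) : vec := (t.2 : nat)%:Z *: delta_mx 0 0.
have [Th ThP] := choice (fun t : T =>
  let: ex_intro2 f Gf fE := generated_realize t.1.1 t.1.2 (vT t) in
  ex_intro (fun f => generated gens f /\ forall h, gen h -> f (q h) = q (model_map t.1.1 t.1.2 (vT t) h)) f (conj Gf fE)).
have cT : #|{: T}| = (2 * n * lattice_index e k)%N by rewrite !card_prod card_bool !card_ord.
have -> : AutG R kk = range (fun i : 'I_(2 * n * lattice_index e k) => Th (enum_val (cast_ord (esym cT) i))).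
  apply/seteqP; split=> f; last first.
    by case=> i _ <-; rewrite -generated_gens; case: (ThP (enum_val (cast_ord (esym cT) i))).
  move=> Af; have [b [c [v fE]]] := aut_form large q_surj q_eq q_adj Af.
  have [a La] := quotient_cyclic k0 v.
  exists (cast_ord cT (enum_rank ((b, c, a) : T))) => //; rewrite cast_ordK enum_rankK.
  apply/funext => u; have [h gh <-] := q_surj u; rewrite fE // (ThP _).2 //=.
  apply/q_eq; [exact: gen_Y | exact: gen_Y | exact: Y_eqv].
apply: range_ord_card => i j E; apply: (@cast_ord_inj _ _ (esym cT)); apply: enum_val_inj.
move: (enum_val _) (enum_val _) E => t t' E.
have [h gh|Eb Ec La] := @Y_inj e k large t.1.1 t'.1.1 t.1.2 t'.1.2 (vT t) (vT t').
  by apply/q_eq; [exact: gen_Y | exact: gen_Y | rewrite -(ThP t).2 // -(ThP t').2 // E].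
have Ea := quotient_cyclic_inj k0 La.
by case: t t' Eb Ec Ea {E La} => [[b c] a] [[b' c'] a'] /= -> -> ->.
Qed.

End Assembly.

Theorem theorem6p2 (R : realType) (d k : nat)
    (hd : (2 <= d)%N) (hk : (1 <= k)%N) (hne : ~ (d = 2%N /\ k = 1%N)) :
  let kk := fun _ : 'I_d.+1 => k in
  generated (graph_induced (Taut R kk `|` Raut R kk `|` Caut R kk)) = AutG R kk
  /\ exists2 n : nat, n%:Z = 2 * d.+1%:Z * \det (Mmat kk) & AutG R kk #= `I_n.
Proof.
case: d hd hne => [|[|e]] // _ hne kk.
have large : ((0 < k) && ((0 < e) || (1 < k)))%N.
  apply/andP; split; first exact: hk.
  case: e hne {kk} => [|e] // hne; rewrite orFb ltn_neqAle; apply/andP; split=> //.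
  by apply/eqP => k1; apply: hne; rewrite -k1.
have [q qP] := vertex_choice R e k; split; first exact: generated_gens qP.
exists (2 * e.+3 * lattice_index e k)%N; last exact: card_AutG qP.
by rewrite det_Mmat // !PoszM.
Qed.
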